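(* Let $\gamma_1,\gamma_2>0$ be real numbers such that either $\gamma_1-\gamma_2-e(e+1)\geq e\sinh 1$ or $1-e(1+\gamma_1+\gamma_2)\geq \sinh 1$. If $p$ is an analytic function in $\mathbb{D}$ such that $p(0)=1$ and $$p(z)+\gamma_1 zp'(z)+\gamma_2 z^2p''(z)\prec 1+\sin z,$$ then $p(z)\prec e^z$.
   Context: $\mathbb{D}=\{z\in\mathbb{C}:|z|<1\}$ is the open unit disk. For analytic functions $g,h$ on $\mathbb{D}$, $g\prec h$ ($g$ is subordinate to $h$) means that there is an analytic function $w:\mathbb{D}\to\mathbb{D}$ with $w(0)=0$ and $|w(z)|\le|z|$ such that $g(z)=h(w(z))$ for all $z\in\mathbb{D}$. *)

(* Defs.v *)
From Stdlib Require Import Reals.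
From Coquelicot Require Import Coquelicot.

Open Scope C_scope.

Definition unit_disk (z : C) : Prop := Cmod z < 1.

(* A function on the disk is represented by a total function [C -> C]; only its
   values on the (open) disk matter, also for [ex_derive] and [C_derive].
   [ex_derive] over [C_AbsRing] is complex differentiability. *)
Definition analytic_on_disk (f : C -> C) : Prop :=
  forall z : C, unit_disk z -> @ex_derive C_AbsRing C_NormedModule f z.

Definition subordinate (g h : C -> C) : Prop :=
  exists w : C -> C,
    analytic_on_disk w /\
    (forall z : C, unit_disk z -> unit_disk (w z)) /\
    w 0 = 0 /\
    (forall z : C, unit_disk z -> Cmod (w z) <= Cmod z) /\
    (forall z : C, unit_disk z -> g z = h (w z)).

Definition Cexp (z : C) : C :=
  (exp (Re z) * cos (Im z), exp (Re z) * sin (Im z))%R.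

Definition Csin (z : C) : C :=
  (Cexp (Ci * z) - Cexp (- (Ci * z))) / (2 * Ci).

(* Main.v *)
Require Import Defs.
From Stdlib Require Import Reals Lra Psatz ClassicalEpsilon.
From Coquelicot Require Import Coquelicot.

(** The second alternative on the coefficients is impossible, because e > 1 and
    sinh 1 > 0, and the first one gives c := gamma1 - gamma2 >= 7.  This is so
    large that p has to stay very close to 1, and then log p is a subordinating
    function.

    Fix z in the disk and follow p along the ray s |-> s z, 0 <= s <= 1.  With
    u(s) = p(sz) - 1 and v(s) = s u'(s), the hypothesis becomes,
    for the subordinating function w,
        gamma2 s v' + c v + u = sin (w(sz)),    |sin (w(sz))| <= 2 |z| s.
    Let M be the maximum of |u'| on [0,1], so that |u(s)| <= M s.  For a
    real part y = Re (lam v), |lam| = 1, and K = (2|z| + M) / c, the equation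
    makes y' negative wherever y - K s is positive, so y - K s, which vanishes
    at 0, has no positive maximum, and |v(s)| <= K s.  Hence M <= (2|z| + M) / c, and therefore
    |p(z) - 1| <= M <= 2|z| / (c - 1) <= |z| / 3 ([euler_second_order_bound],
    [subordination_distance]).  The principal logarithm satisfies
    |log (1 + u)| <= 3 |u| for |u| <= 1/3, so log p is holomorphic and
    |log p(z)| <= |z| ([cderiv_Clog], [Clog_bound]).

    The ray argument differentiates p twice, whereas analyticity is given as
    complex differentiability only; since the second derivative in the
    hypothesis is a total operator, nothing can be read off that equation until
    p' is known to be differentiable.  So the classical regularity theorem is
    proved first ([analytic_C_derive]): Goursat's bisection argument, performed
    in the parameters of a mapped square, shows that integrals of holomorphic
    functions over homotopic circles agree; this yields Cauchy's formula, whose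
    right-hand side can be differentiated under the integral sign as often as
    one likes. *)

Open Scope C_scope.

(** * Complex and real derivatives, continuity and integrals of complex functions *)

Notation cderiv := (@is_derive C_AbsRing C_NormedModule).
Notation rderiv := (@is_derive R_AbsRing C_R_NormedModule).
Notation ccont := (@continuous R_UniformSpace C_R_NormedModule).
Notation is_CInt := (@is_RInt C_R_NormedModule).
Notation CInt := (@RInt C_R_CompleteNormedModule).

Lemma norm_C_R (x : C) : @norm R_AbsRing C_R_NormedModule x = Cmod x.
Proof. symmetry; apply Cmod_norm. Qed.

(** Working with explicit epsilons avoids the two uniform structures that C
    carries, one as a normed ring and one as a product. *)
Lemma cderiv_eps (f : C -> C) (z l : C) :
  cderiv f z l <->
  forall eps, (0 < eps)%R -> exists del, (0 < del)%R /\ forall w,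
    (Cmod (w - z) < del)%R ->
    (Cmod (f w - f z - (w - z) * l) <= eps * Cmod (w - z))%R.
Proof.
split.
- intros [_ H] eps He.
  destruct (H z (fun P HP => HP) (mkposreal eps He)) as [d Hd].
  exists d; split; [apply cond_pos|]. intros w Hw. exact (Hd w Hw).
- intros H; split.
  + apply (is_linear_scal_l l).
  + intros x Hx.
    rewrite <- (@is_filter_lim_locally_unique C_AbsRing (AbsRing_NormedModule C_AbsRing) z x Hx).
    intros eps. destruct (H eps (cond_pos eps)) as [d [Hd0 Hd]].
    exists (mkposreal d Hd0). intros w Hw. exact (Hd w Hw).
Qed.

Lemma rderiv_eps (f : R -> C) t l :
  rderiv f t l <->
  forall eps, (0 < eps)%R -> exists del, (0 < del)%R /\ forall s,
    (Rabs (s - t) < del)%R ->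
    (Cmod (f s - f t - RtoC (s - t) * l) <= eps * Rabs (s - t))%R.
Proof.
assert (E : forall s, minus (minus (f s) (f t)) (@scal R_AbsRing C_R_NormedModule (s - t)%R l) = (f s - f t - RtoC (s - t) * l)).
{ intros s. apply injective_projections.
  - change ((fst (f s) + - fst (f t) + - ((s - t) * fst l)
    = (fst (f s) + - fst (f t)) + - ((s-t)* fst l - 0 * snd l))%R). ring.
  - change ((snd (f s) + - snd (f t) + - ((s - t) * snd l)
    = (snd (f s) + - snd (f t)) + - ((s-t)* snd l + 0 * fst l))%R). ring. }
split.
- intros [_ H] eps He.
  destruct (H t (fun P HP => HP) (mkposreal eps He)) as [d Hd].
  exists d; split; [apply cond_pos|]. intros s Hs.
  rewrite <- E, <- norm_C_R. exact (Hd s Hs).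
- intros H; split.
  + apply (is_linear_scal_l l).
  + intros x Hx.
    rewrite <- (is_filter_lim_locally_unique t x Hx).
    intros eps. destruct (H eps (cond_pos eps)) as [d [Hd0 Hd]].
    exists (mkposreal d Hd0). intros s Hs.
    change (@norm R_AbsRing C_R_NormedModule (minus (minus (f s) (f t)) (@scal R_AbsRing C_R_NormedModule (s - t)%R l)) <= eps * Rabs (s - t))%R.
    rewrite norm_C_R, E. apply Hd. exact Hs.
Qed.

Lemma rderiv_pair (x y : R -> R) t dx dy :
  is_derive x t dx -> is_derive y t dy ->
  rderiv (fun s => (x s, y s)) t (dx, dy).
Proof.
intros Hx Hy.
generalize (filterdiff_comp'_2 x y (fun u v => (u,
  v) : C_R_NormedModule) t _ _ (fun u v => (u, v) : C_R_NormedModule) Hx Hy).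
intros H. unfold is_derive.
eapply filterdiff_ext_lin. apply H.
apply filterdiff_linear.
split.
- intros; reflexivity.
- intros; reflexivity.
- exists 1%R. split. lra. intros [u v]. simpl. rewrite Rmult_1_l. apply Rle_refl.
- intros s. reflexivity.
Qed.

Lemma ccont_pair (f : R -> C) t :
  continuous (fun s => fst (f s)) t -> continuous (fun s => snd (f s)) t ->
  ccont f t.
Proof.
intros H1 H2 P [eps HP].
specialize (H1 _ (locally_ball _ eps)). specialize (H2 _ (locally_ball _ eps)).
unfold filtermap in *.
generalize (filter_and _ _ H1 H2). apply filter_imp.
intros s [A B]. apply HP. split; assumption.
Qed.

Lemma ccont_fst (f : R -> C) t : ccont f t -> continuous (fun s => fst (f s)) t.
Proof. intros H. apply (continuous_comp f fst); [exact H|]. apply continuous_fst. Qed.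

Lemma ccont_snd (f : R -> C) t : ccont f t -> continuous (fun s => snd (f s)) t.
Proof. intros H. apply (continuous_comp f snd); [exact H|]. apply continuous_snd. Qed.

Lemma ccont_mult (f g : R -> C) t : ccont f t -> ccont g t -> ccont (fun s => f s * g s) t.
Proof.
intros Hf Hg. apply ccont_pair; simpl.
- apply (continuous_minus (V := R_NormedModule)); apply (continuous_mult (K:=R_AbsRing));
  auto using ccont_fst, ccont_snd.
- apply (continuous_plus (V := R_NormedModule)); apply (continuous_mult (K:=R_AbsRing));
  auto using ccont_fst, ccont_snd.
Qed.

Lemma ccont_eps (f : R -> C) t : ccont f t <->
  forall eps, (0 < eps)%R -> exists del, (0 < del)%R /\ forall s,
    (Rabs (s - t) < del)%R -> (Cmod (f s - f t) < eps)%R.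
Proof.
split.
- intros H eps He.
  assert (He2 : (0 < eps / 2)%R) by lra.
  destruct (H _ (locally_ball _ (mkposreal _ He2))) as [d Hd].
  exists d; split; [apply cond_pos|]. intros s Hs.
  destruct (Hd s Hs) as [A B].
  eapply Rle_lt_trans. apply Cmod_2Rmax.
  assert (Q : (sqrt 2 < 2)%R). { rewrite <- (sqrt_square 2) at 2 by lra. apply sqrt_lt_1; lra. }
  assert (M : (Rmax (Rabs (fst (f s - f t)%C)) (Rabs (snd (f s - f t)%C)) < eps / 2)%R).
  { apply Rmax_lub_lt; assumption. }
  assert (0 <= Rmax (Rabs (fst (f s - f t)%C)) (Rabs (snd (f s - f t)%C)))%R.
  { eapply Rle_trans. 2: apply Rmax_l. apply Rabs_pos. }
  assert (0 <= sqrt 2)%R by apply sqrt_pos.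
  nra.
- intros H P [eps HP]. destruct (H eps (cond_pos eps)) as [d [Hd0 Hd]].
  exists (mkposreal d Hd0). intros s Hs. apply HP.
  specialize (Hd s Hs). generalize (Rmax_Cmod (f s - f t)). intros M.
  split; [apply Rle_lt_trans with (2 := Hd), Rle_trans with (2 := M), Rmax_l
         |apply Rle_lt_trans with (2 := Hd), Rle_trans with (2 := M), Rmax_r].
Qed.

Lemma is_CInt_mult_l (c : C) (f : R -> C) a b l : is_CInt f a b l ->
  is_CInt (fun t => c * f t) a b (c * l).
Proof.
intros H.
apply (is_RInt_fct_extend_pair (U:=R_NormedModule) (V:=R_NormedModule)).
- apply (is_RInt_minus (V:=R_NormedModule)); apply (is_RInt_scal (V:=R_NormedModule)).
  + apply (is_RInt_fct_extend_fst (U:=R_NormedModule) (V:=R_NormedModule)); exact H.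
  + apply (is_RInt_fct_extend_snd (U:=R_NormedModule) (V:=R_NormedModule)); exact H.
- apply (is_RInt_plus (V:=R_NormedModule)); apply (is_RInt_scal (V:=R_NormedModule)).
  + apply (is_RInt_fct_extend_snd (U:=R_NormedModule) (V:=R_NormedModule)); exact H.
  + apply (is_RInt_fct_extend_fst (U:=R_NormedModule) (V:=R_NormedModule)); exact H.
Qed.

Lemma CInt_correct (f : R -> C) a b :
  (a <= b)%R -> (forall t, (a <= t <= b)%R -> ccont f t) -> is_CInt f a b (CInt f a b).
Proof.
intros Hab H. apply (RInt_correct (V := C_R_CompleteNormedModule)).
apply (ex_RInt_continuous (V := C_R_CompleteNormedModule)).
rewrite Rmin_left, Rmax_right by assumption. exact H.
Qed.

Lemma CInt_Chasles (f : R -> C) a b c :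
  (a <= b <= c)%R -> (forall t, (a <= t <= c)%R -> ccont f t) ->
  CInt f a c = CInt f a b + CInt f b c.
Proof.
intros Hab H. symmetry. apply (RInt_Chasles (V := C_R_CompleteNormedModule)); eexists;
apply CInt_correct; try lra; intros; apply H; lra.
Qed.

Lemma is_CInt_norm_le (f : R -> C) a b l K :
  (a <= b)%R -> (forall t, (a <= t <= b)%R -> (Cmod (f t) <= K)%R) ->
  is_CInt f a b l -> (Cmod l <= (b - a) * K)%R.
Proof.
intros Hab H Hi. rewrite <- norm_C_R. apply (norm_RInt_le_const (V:=C_R_NormedModule) f a b);
  auto.
intros. rewrite norm_C_R. auto.
Qed.

Lemma is_CInt_minus (f g : R -> C) a b l m :
  is_CInt f a b l -> is_CInt g a b m -> is_CInt (fun t => f t - g t) a b (l - m).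
Proof. apply (is_RInt_minus (V:=C_R_NormedModule)). Qed.

Lemma CInt_unique f a b l : is_CInt f a b l -> CInt f a b = l.
Proof. apply (is_RInt_unique (V:=C_R_CompleteNormedModule)). Qed.

Lemma is_CInt_FTC (f df : R -> C) a b :
  (a <= b)%R -> (forall t, (a <= t <= b)%R -> rderiv f t (df t)) ->
  (forall t, (a <= t <= b)%R -> ccont df t) ->
  is_CInt df a b (f b - f a).
Proof.
intros Hab H1 H2. apply (is_RInt_derive (V:=C_R_CompleteNormedModule));
  rewrite Rmin_left, Rmax_right by assumption; assumption.
Qed.

Lemma cderiv_lip (f : C -> C) (z l : C) : cderiv f z l -> exists del, (0 < del)%R /\ forall w,
    (Cmod (w - z) < del)%R -> (Cmod (f w - f z) <= (Cmod l + 1) * Cmod (w - z))%R.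
Proof.
intros H. destruct (proj1 (cderiv_eps f z l) H 1%R) as [d [Hd0 Hd]]; [lra|].
exists d; split; auto. intros w Hw. specialize (Hd w Hw).
replace (f w - f z) with ((f w - f z - (w - z) * l) + (w - z) * l) by ring.
eapply Rle_trans. apply Cmod_triangle. rewrite Cmod_mult. lra.
Qed.

Lemma rderiv_lip (f : R -> C) t (l : C) : rderiv f t l -> exists del, (0 < del)%R /\ forall w,
    (Rabs (w - t) < del)%R -> (Cmod (f w - f t) <= (Cmod l + 1) * Rabs (w - t))%R.
Proof.
intros H. destruct (proj1 (rderiv_eps f t l) H 1%R) as [d [Hd0 Hd]]; [lra|].
exists d; split; auto. intros w Hw. specialize (Hd w Hw).
replace (f w - f t) with ((f w - f t - RtoC (w - t) * l) + RtoC (w - t) * l) by ring.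
eapply Rle_trans. apply Cmod_triangle. rewrite Cmod_mult, Cmod_R. lra.
Qed.

Lemma rderiv_ccont (f : R -> C) t (l : C) : rderiv f t l -> ccont f t.
Proof. intros H. apply (ex_derive_continuous (V := C_R_NormedModule)). exists l; exact H. Qed.

Lemma ccont_cderiv_comp (f : C -> C) (c : R -> C) t l : cderiv f (c t) l -> ccont c t ->
  ccont (fun s => f (c s)) t.
Proof.
intros Hf Hc. apply ccont_eps. intros eps He.
destruct (cderiv_lip _ _ _ Hf) as [d [Hd0 Hd]].
assert (P : (0 < Cmod l + 1)%R) by (generalize (Cmod_ge_0 l); lra).
destruct (proj1 (ccont_eps c t) Hc (Rmin d (eps / (Cmod l + 1)))) as [r [Hr0 Hr]].
{ apply Rmin_case; auto. apply Rdiv_lt_0_compat; auto. }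
exists r; split; auto. intros s Hs. specialize (Hr s Hs).
eapply Rle_lt_trans. apply Hd. eapply Rlt_le_trans. apply Hr. apply Rmin_l.
apply Rlt_le_trans with ((Cmod l + 1) * (eps / (Cmod l + 1)))%R.
- apply Rmult_lt_compat_l; auto. eapply Rlt_le_trans. apply Hr. apply Rmin_r.
- right. field. lra.
Qed.

Lemma rderiv_comp (f : C -> C) (c : R -> C) t l m : cderiv f (c t) l -> rderiv c t m ->
  rderiv (fun s => f (c s)) t (m * l).
Proof.
intros Hf Hc. apply rderiv_eps. intros eps He.
destruct (rderiv_lip _ _ _ Hc) as [d1 [Hd10 Hd1]].
generalize (Cmod_ge_0 l) (Cmod_ge_0 m). intros Pl Pm.
set (e1 := (eps / (2 * (Cmod m + 1)))%R). set (e2 := (eps / (2 * (Cmod l + 1)))%R).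
assert (He1 : (0 < e1)%R) by (apply Rdiv_lt_0_compat; lra).
assert (He2 : (0 < e2)%R) by (apply Rdiv_lt_0_compat; lra).
assert (E1 : (e1 * (Cmod m + 1) = eps / 2)%R) by (unfold e1; field; lra).
assert (E2 : (e2 * (Cmod l + 1) = eps / 2)%R) by (unfold e2; field; lra).
destruct (proj1 (cderiv_eps f _ l) Hf e1 He1) as [d2 [Hd20 Hd2]].
destruct (proj1 (rderiv_eps c t m) Hc e2 He2) as [d3 [Hd30 Hd3]].
destruct (proj1 (ccont_eps c t) (rderiv_ccont _ _ _ Hc) d2 Hd20) as [d4 [Hd40 Hd4]].
exists (Rmin (Rmin d1 d3) d4). split. repeat apply Rmin_case; auto.
intros s Hs.
assert (Rabs (s - t) < d1)%R by (eapply Rlt_le_trans; [apply Hs|]; eapply Rle_trans;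
  [apply Rmin_l|apply Rmin_l]).
assert (Rabs (s - t) < d3)%R by (eapply Rlt_le_trans; [apply Hs|]; eapply Rle_trans;
  [apply Rmin_l|apply Rmin_r]).
assert (Rabs (s - t) < d4)%R by (eapply Rlt_le_trans; [apply Hs|]; apply Rmin_r).
specialize (Hd1 s H). specialize (Hd3 s H0). specialize (Hd4 s H1). specialize (Hd2 _ Hd4).
replace (f (c s) - f (c t) - (s - t)%R * (m * l)) with
  ((f (c s) - f (c t) - (c s - c t) * l) + (c s - c t - (s - t)%R * m) * l) by ring.
eapply Rle_trans. apply Cmod_triangle. rewrite Cmod_mult.
assert (A : (e1 * Cmod (c s - c t) <= e1 * ((Cmod m + 1) * Rabs (s - t)))%R) by
  (apply Rmult_le_compat_l; lra).
assert (B : (Cmod (c s - c t - (s - t)%R * m) * Cmod l <= e2 * Rabs (s - t) * (Cmod l + 1))%R).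
{ apply Rmult_le_compat; try lra. apply Cmod_ge_0. }
replace (e1 * ((Cmod m + 1) * Rabs (s - t)))%R with
  (eps / 2 * Rabs (s - t))%R in A by (rewrite <- E1; ring).
replace (e2 * Rabs (s - t) * (Cmod l + 1))%R with
  (eps / 2 * Rabs (s - t))%R in B by (rewrite <- E2; ring).
lra.
Qed.

(** * Bisection of squares and Goursat's theorem *)

Section Bisection.
Open Scope R_scope.
Definition in_unit a h := 0 <= a /\ a + h <= 1.

(** Otherwise a nested sequence of bad squares, each a quarter of the previous
    one, shrinks to a point (x, y), and the second hypothesis at (x, y) is
    contradicted. *)
Lemma square_bisection (Good : R -> R -> R -> Prop) :
  (forall a b h, 0 < h -> in_unit a h -> in_unit b h ->
     Good a b (h / 2) -> Good (a + h / 2) b (h / 2) ->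
     Good a (b + h / 2) (h / 2) -> Good (a + h / 2) (b + h / 2) (h / 2) -> Good a b h) ->
  (forall x y, 0 <= x <= 1 -> 0 <= y <= 1 -> exists del, 0 < del /\
     forall a b h, 0 < h < del -> in_unit a h -> in_unit b h ->
       a <= x <= a + h -> b <= y <= b + h -> Good a b h) ->
  Good 0 0 1.
Proof.
intros Hstep Hloc. apply NNPP. intros Hbad.
set (inv := fun (q : R * R) h => 0 < h /\ in_unit (fst q) h /\ in_unit (snd q) h /\ ~ Good (fst q) (snd q) h).
set (nxt := fun q h (q' : R * R) =>
   (fst q <= fst q' <= fst q + h / 2) /\ (snd q <= snd q' <= snd q + h / 2) /\ inv q' (h / 2)).
assert (Hex : forall q h, exists q', inv q h -> nxt q h q').
{ intros [a b] h. destruct (classic (exists q', nxt (a, b) h q')) as [[q' Hq]|Hn].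
  - exists q'. auto.
  - exists (a, b). intros [Hh [Ha [Hb HG]]]. exfalso. simpl in *. apply HG.
    unfold in_unit in *.
    assert (K : forall a' b', (a' = a \/ a' = a + h / 2) -> (b' = b \/ b' = b + h / 2) ->
      Good a' b' (h / 2)).
    { intros a' b' Ha' Hb'. apply NNPP. intros Hng. apply Hn. exists (a', b').
      unfold nxt, inv, in_unit; simpl. repeat split; try (destruct Ha', Hb'; subst;
        lra). exact Hng. }
    apply Hstep; unfold in_unit; auto. }
set (next := fun q h => proj1_sig (constructive_indefinite_description _ (Hex q h))).
assert (Hnext : forall q h, inv q h -> nxt q h (next q h)).
{ intros q h. apply (proj2_sig (constructive_indefinite_description _ (Hex q h))). }
set (hh := fun n : nat => (/ 2) ^ n).
set (seq := fix seq n := match n with O => (0, 0) | S n => next (seq n) (hh n) end).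
assert (Hh : forall n, hh (S n) = hh n / 2) by (intros; unfold hh; simpl; field).
assert (Hinv : forall n, inv (seq n) (hh n)).
{ induction n.
  - unfold inv, in_unit, hh; simpl. repeat split; try lra. exact Hbad.
  - rewrite Hh. apply (Hnext _ _ IHn). }
assert (Hpos : forall n, 0 < hh n) by (intros n; apply (Hinv n)).
assert (Hs : forall n, nxt (seq n) (hh n) (seq (S n))) by (intros n;
  apply (Hnext _ _ (Hinv n))).
(* nested intervals, for each of the two coordinates *)
assert (Hlim : forall u : nat -> R, (forall n, 0 <= u n /\ u n + hh n <= 1) ->
  (forall n, u n <= u (S n) <= u n + hh n / 2) ->
   exists l, forall n, u n <= l <= u n + hh n).
{ intros u Hu Hu'.
  assert (Hup : forall n k, u n <= u (n + k)%nat).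
  { induction k. rewrite Nat.add_0_r;
    lra. rewrite Nat.add_succ_r. generalize (Hu' (n + k)%nat); lra. }
  assert (Hdown : forall n k, u (n + k)%nat + hh (n + k)%nat <= u n + hh n).
  { induction k. rewrite Nat.add_0_r;
    lra. rewrite Nat.add_succ_r, Hh. generalize (Hu' (n + k)%nat); lra. }
  assert (Hb : forall n m, u m <= u n + hh n).
  { intros n m. destruct (Nat.le_ge_cases n m) as [L|L].
    - replace m with (n + (m - n))%nat by (rewrite Nat.add_comm; apply Nat.sub_add; exact L).
      generalize (Hdown n (m - n)%nat) (Hpos (n + (m - n))%nat); lra.
    - replace n with (m + (n - m))%nat by (rewrite Nat.add_comm; apply Nat.sub_add; exact L).
      generalize (Hup m (n - m)%nat) (Hpos (m + (n - m))%nat); lra. }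
  destruct (completeness (fun r => exists n, r = u n)) as [l [Hl1 Hl2]].
  - exists (u 0%nat + hh 0%nat). intros r [n ->]. apply Hb.
  - exists (u 0%nat). exists 0%nat. reflexivity.
  - exists l. intros n. split. apply Hl1. exists n; reflexivity.
    apply Hl2. intros r [m ->]. apply Hb. }
destruct (Hlim (fun n => fst (seq n))) as [x Hx].
{ intros n. apply (Hinv n). } { intros n. apply (Hs n). }
destruct (Hlim (fun n => snd (seq n))) as [y Hy].
{ intros n. apply (Hinv n). } { intros n. apply (Hs n). }
destruct (Hloc x y) as [del [Hdel Hd]].
{ generalize (Hx 0%nat); unfold hh; simpl; lra. } { generalize (Hy 0%nat); unfold hh; simpl;
  lra. }
destruct (pow_lt_1_zero (/ 2) ltac:(rewrite Rabs_pos_eq; lra) del Hdel) as [N HN].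
specialize (HN N (le_n N)). rewrite Rabs_pos_eq in HN by (apply Rlt_le, Hpos).
destruct (Hinv N) as [I1 [I2 [I3 I4]]]. apply I4.
apply Hd; auto.
Qed.

End Bisection.

(** Over one edge, replacing g by a function with primitive P costs at most the
    length of the edge times the error.  Around a closed polygon the increments
    of P cancel. *)
Lemma edge_integral (g P dP : C -> C) (c dc : R -> C) a b K :
  (a <= b)%R ->
  (forall t, (a <= t <= b)%R -> rderiv c t (dc t)) ->
  (forall t, (a <= t <= b)%R -> ccont dc t) ->
  (forall t, (a <= t <= b)%R -> exists l, cderiv g (c t) l) ->
  (forall w, cderiv P w (dP w)) -> (forall w, exists l, cderiv dP w l) ->
  (forall t, (a <= t <= b)%R -> (Cmod (g (c t) - dP (c t)) * Cmod (dc t) <= K)%R) ->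
  (Cmod (CInt (fun t => (g (c t) * dc t)%C) a b - (P (c b) - P (c a))) <= (b - a) * K)%R.
Proof.
intros Hab Hc Hdc Hg HP HdP HK.
assert (Cc : forall t, (a <= t <= b)%R -> ccont c t) by (intros t Ht;
  eapply rderiv_ccont, Hc, Ht).
apply is_CInt_norm_le with (f := fun t => g (c t) * dc t - dc t * dP (c t)); auto.
- intros t Ht. replace (g (c t) * dc t - dc t * dP (c t)) with
  ((g (c t) - dP (c t)) * dc t) by ring.
  rewrite Cmod_mult. auto.
- apply is_CInt_minus.
  + apply CInt_correct; auto. intros t Ht. apply ccont_mult; auto.
    destruct (Hg t Ht) as [l Hl]. eapply ccont_cderiv_comp; eauto.
  + apply (is_CInt_FTC (fun t => P (c t))); auto.
    * intros t Ht. apply rderiv_comp; auto.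
    * intros t Ht. apply ccont_mult; auto. destruct (HdP (c t)) as [l Hl].
      eapply ccont_cderiv_comp; eauto.
Qed.

Lemma cderiv_affine g0 l z w : cderiv (fun w => g0 + l * (w - z)) w l.
Proof.
apply cderiv_eps. intros eps He. exists 1%R. split; [lra|]. intros v _.
replace (g0 + l * (v - z) - (g0 + l * (w - z)) - (v - w) * l) with (RtoC 0) by ring.
rewrite Cmod_0. generalize (Cmod_ge_0 (v - w)). nra.
Qed.

Lemma cderiv_affine_primitive g0 l z w : cderiv
  (fun w => g0 * w + l / 2 * (w - z) * (w - z)) w (g0 + l * (w - z)).
Proof.
apply cderiv_eps. intros eps He. generalize (Cmod_ge_0 (l / 2)); intros Hl.
exists (eps / (Cmod (l / 2) + 1))%R. split; [apply Rdiv_lt_0_compat; lra|]. intros v Hv.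
replace (g0 * v + l / 2 * (v - z) * (v - z) - (g0 * w + l / 2 * (w - z) * (w - z)) - (v - w) * (g0 + l * (w - z)))
 with (l / 2 * (v - w) * (v - w)).
2:{ field.  }
rewrite !Cmod_mult. apply Rmult_le_compat_r. apply Cmod_ge_0.
apply Rle_trans with ((Cmod (l / 2) + 1) * (eps / (Cmod (l / 2) + 1)))%R.
- apply Rmult_le_compat; try lra. apply Cmod_ge_0.
- right; field; lra.
Qed.

Lemma rderiv_increment_le (c dc : R -> C) a b L :
  (a <= b)%R ->
  (forall t, (a <= t <= b)%R -> rderiv c t (dc t)) ->
  (forall t, (a <= t <= b)%R -> ccont dc t) ->
  (forall t, (a <= t <= b)%R -> (Cmod (dc t) <= L)%R) ->
  (Cmod (c b - c a) <= (b - a) * L)%R.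
Proof.
intros Hab H1 H2 H3. apply is_CInt_norm_le with (f := dc); auto. apply is_CInt_FTC; auto.
Qed.

Section Goursat.
Variables (g : C -> C) (Phi Phix Phiy : R -> R -> C) (L : R).
Hypothesis HPx : forall x y, (0 <= x <= 1 -> 0 <= y <= 1 ->
  rderiv (fun x => Phi x y) x (Phix x y))%R.
Hypothesis HPy : forall x y, (0 <= x <= 1 -> 0 <= y <= 1 ->
  rderiv (fun y => Phi x y) y (Phiy x y))%R.
Hypothesis HCx : forall x y, (0 <= x <= 1 -> 0 <= y <= 1 -> ccont (fun x => Phix x y) x)%R.
Hypothesis HCy : forall x y, (0 <= x <= 1 -> 0 <= y <= 1 -> ccont (fun y => Phiy x y) y)%R.
Hypothesis HLx : forall x y, (0 <= x <= 1 -> 0 <= y <= 1 -> Cmod (Phix x y) <= L)%R.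
Hypothesis HLy : forall x y, (0 <= x <= 1 -> 0 <= y <= 1 -> Cmod (Phiy x y) <= L)%R.
Hypothesis Hg : forall x y, (0 <= x <= 1 -> 0 <= y <= 1 -> exists l, cderiv g (Phi x y) l)%R.

Let EX a b y := CInt (fun x => g (Phi x y) * Phix x y) a b.
Let EY x a b := CInt (fun y => g (Phi x y) * Phiy x y) a b.
Let circ a b h := EX a (a + h) b + EY (a + h) b (b + h) - EX a (a + h) (b + h) - EY a b (b + h).

(** Edges shared by two quarters are traversed in opposite directions. *)
Lemma circ_quarters a b h :
  (0 < h)%R -> in_unit a h -> in_unit b h ->
  circ a b h = circ a b (h / 2)%R + circ (a + h / 2)%R b (h / 2)%R
    + circ a (b + h / 2)%R (h / 2)%R + circ (a + h / 2)%R (b + h / 2)%R (h / 2)%R.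
Proof.
unfold in_unit. intros Hh Ha Hb.
assert (X : forall y, (0 <= y <= 1)%R ->
  EX a (a + h) y = EX a (a + h / 2) y + EX (a + h / 2) (a + h) y).
{ intros y Hy. apply CInt_Chasles; [lra|]. intros t Ht. apply ccont_mult; [|apply HCx; lra].
  destruct (Hg t y) as [l Hl]; try lra. apply ccont_cderiv_comp with l; auto.
  eapply rderiv_ccont, HPx; lra. }
assert (Y : forall x, (0 <= x <= 1)%R ->
  EY x b (b + h) = EY x b (b + h / 2) + EY x (b + h / 2) (b + h)).
{ intros x Hx. apply CInt_Chasles; [lra|]. intros t Ht. apply ccont_mult; [|apply HCy; lra].
  destruct (Hg x t) as [l Hl]; try lra. apply ccont_cderiv_comp with l; auto.
  eapply rderiv_ccont, HPy; lra. }
unfold circ.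
replace (a + h / 2 + h / 2)%R with (a + h)%R by field.
replace (b + h / 2 + h / 2)%R with (b + h)%R by field.
rewrite !X, !Y by lra. ring.
Qed.

(** Near (x, y) the function g is affine in Phi up to e * |Phi - Phi x y|.  The affine
    part has a primitive and contributes nothing; in a square of side h the error
    is O(e h) on edges of total length O(h). *)
Lemma circ_local eps x y : (0 < eps)%R -> (0 <= x <= 1)%R -> (0 <= y <= 1)%R ->
  exists del, (0 < del)%R /\
     forall a b h, (0 < h < del)%R -> in_unit a h -> in_unit b h ->
       (a <= x <= a + h)%R -> (b <= y <= b + h)%R -> (Cmod (circ a b h) <= eps * (h * h))%R.
Proof.
intros He Hx Hy.
destruct (Hg x y Hx Hy) as [l Hl].
set (z := Phi x y) in *.
assert (L0 : (0 <= L)%R) by (eapply Rle_trans; [apply Cmod_ge_0|apply (HLx x y Hx Hy)]).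
set (e := (eps / (8 * (L + 1) * (L + 1)))%R).
assert (He' : (0 < e)%R) by (apply Rdiv_lt_0_compat; [auto|nra]).
destruct (proj1 (cderiv_eps g z l) Hl e He') as [d [Hd0 Hd]].
exists (d / (2 * (L + 1)))%R. split. apply Rdiv_lt_0_compat; lra.
unfold in_unit. intros a b h Hh Ha Hb Hax Hby.
assert (Hhd : (2 * (L + 1) * h < d)%R).
{ apply Rlt_le_trans with (2 * (L + 1) * (d / (2 * (L + 1))))%R. apply Rmult_lt_compat_l;
  lra. right; field; lra. }
assert (IX : forall x1 x2 y, (0 <= x1)%R -> (x1 <= x2)%R -> (x2 <= 1)%R -> (0 <= y <= 1)%R ->
  (Cmod (Phi x2 y - Phi x1 y) <= (x2 - x1) * L)%R).
{ intros. apply (rderiv_increment_le (fun x => Phi x y0) (fun x => Phix x y0)); auto; intros;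
  auto; [apply HPx|apply HCx|apply HLx]; lra. }
assert (IY : forall y1 y2 x, (0 <= y1)%R -> (y1 <= y2)%R -> (y2 <= 1)%R -> (0 <= x <= 1)%R ->
  (Cmod (Phi x y2 - Phi x y1) <= (y2 - y1) * L)%R).
{ intros. apply (rderiv_increment_le (fun y => Phi x0 y) (fun y => Phiy x0 y)); auto; intros;
  auto; [apply HPy|apply HCy|apply HLy]; lra. }
assert (Hdist : forall s t, (a <= s <= a + h)%R -> (b <= t <= b + h)%R ->
  (Cmod (Phi s t - z) <= 2 * (L + 1) * h)%R).
{ intros s t Hs Ht.
  assert (A : (Cmod (Phi s t - Phi x t) <= h * L)%R).
  { destruct (Rle_dec x s).
    - eapply Rle_trans. apply IX; lra. apply Rmult_le_compat_r; lra.
    - replace (Phi s t - Phi x t) with (- (Phi x t - Phi s t)) by ring. rewrite Cmod_opp.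
      eapply Rle_trans. apply IX; lra. apply Rmult_le_compat_r; lra. }
  assert (B : (Cmod (Phi x t - z) <= h * L)%R).
  { unfold z. destruct (Rle_dec y t).
    - eapply Rle_trans. apply IY; lra. apply Rmult_le_compat_r; lra.
    - replace (Phi x t - Phi x y) with (- (Phi x y - Phi x t)) by ring. rewrite Cmod_opp.
      eapply Rle_trans. apply IY; lra. apply Rmult_le_compat_r; lra. }
  replace (Phi s t - z) with ((Phi s t - Phi x t) + (Phi x t - z)) by ring.
  eapply Rle_trans. apply Cmod_triangle. nra. }
set (P := fun w => g z * w + l / 2 * (w - z) * (w - z)).
set (dP := fun w => g z + l * (w - z)).
set (K := (e * (2 * (L + 1) * h) * (L + 1))%R).
assert (HK : forall s t w, (a <= s <= a + h)%R -> (b <= t <= b + h)%R -> (Cmod w <= L)%R ->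
   (Cmod (g (Phi s t) - dP (Phi s t)) * Cmod w <= K)%R).
{ intros s t w Hs Ht Hw. specialize (Hdist s t Hs Ht). unfold K. apply Rmult_le_compat;
  try apply Cmod_ge_0; try lra.
  unfold dP. replace (g (Phi s t) - (g z + l * (Phi s t - z))) with
    (g (Phi s t) - g z - (Phi s t - z) * l) by ring.
  eapply Rle_trans. apply Hd. lra. apply Rmult_le_compat_l; lra. }
assert (HP : forall w, cderiv P w (dP w)) by (intros; apply cderiv_affine_primitive).
assert (HdP : forall w, exists l, cderiv dP w l) by (intros; eexists; apply cderiv_affine).
assert (QX : forall t, (b <= t <= b + h)%R ->
  (Cmod (EX a (a + h) t - (P (Phi (a + h) t) - P (Phi a t))) <= h * K)%R).
{ intros t Ht. replace (h * K)%R with ((a + h - a) * K)%R by ring.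
  apply edge_integral with (dP := dP) (c := fun s => Phi s t); auto; try lra; intros;
  [apply HPx|apply HCx|apply Hg|apply HK; auto; apply HLx]; lra. }
assert (QY : forall s, (a <= s <= a + h)%R ->
  (Cmod (EY s b (b + h) - (P (Phi s (b + h)) - P (Phi s b))) <= h * K)%R).
{ intros t Ht. replace (h * K)%R with ((b + h - b) * K)%R by ring.
  apply edge_integral with (dP := dP) (c := fun s => Phi t s); auto; try lra; intros;
  [apply HPy|apply HCy|apply Hg|apply HK; auto; apply HLy]; lra. }
unfold circ.
replace (EX a (a + h) b + EY (a + h) b (b + h) - EX a (a + h) (b + h) - EY a b (b + h)) with
  ((EX a (a + h) b - (P (Phi (a + h)%R b) - P (Phi a b)))
   + (EY (a + h) b (b + h) - (P (Phi (a + h)%R (b + h)%R) - P (Phi (a + h)%R b)))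
   + (- (EX a (a + h) (b + h) - (P (Phi (a + h)%R (b + h)%R) - P (Phi a (b + h)%R)))
      + - (EY a b (b + h) - (P (Phi a (b + h)%R) - P (Phi a b))))) by ring.
replace (eps * (h * h))%R with (h * K + h * K + (h * K + h * K))%R.
2:{ unfold K, e. field. lra. }
eapply Rle_trans; [apply Cmod_triangle|].
apply Rplus_le_compat; (eapply Rle_trans; [apply Cmod_triangle|]); apply Rplus_le_compat.
- apply QX; lra.
- apply QY; lra.
- rewrite Cmod_opp. apply QX; lra.
- rewrite Cmod_opp. apply QY; lra.
Qed.

(** The boundary integral is at most eps times the area of the square, for every
    eps: this bound passes from the quarters to the whole, and holds for small
    squares.  The parameters are bisected, and not the image, so that the image
    may be an eccentric annulus. *)
Lemma goursat_square : EX 0 1 0 + EY 1 0 1 - EX 0 1 1 - EY 0 0 1 = 0.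
Proof.
apply Cmod_eq_0. apply Rle_antisym; [|apply Cmod_ge_0].
apply Rle_plus_epsilon. intros eps He. rewrite Rplus_0_l.
assert (G : (Cmod (circ 0 0 1) <= eps * (1 * 1))%R).
{ apply (square_bisection (fun a b h => (Cmod (circ a b h) <= eps * (h * h))%R)).
  - intros a b h Hh Ha Hb H1 H2 H3 H4. rewrite circ_quarters by auto.
    apply Rle_trans with (Cmod (circ a b (h / 2)) + Cmod (circ (a + h / 2) b (h / 2))
      + Cmod (circ a (b + h / 2) (h / 2)) + Cmod (circ (a + h / 2) (b + h / 2) (h / 2)))%R.
    + do 2 (eapply Rle_trans; [apply Cmod_triangle|apply Rplus_le_compat_r]).
      apply Cmod_triangle.
    + lra.
  - intros x y Hx Hy. apply circ_local; auto. }
unfold circ in G. rewrite !Rplus_0_l in G. lra.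
Qed.

End Goursat.

(** * Rules for complex derivatives *)

Lemma cderiv_id (z : C) : cderiv (fun w => w) z (RtoC 1).
Proof. apply cderiv_eps. intros eps He. exists 1%R. split; [lra|]. intros v _.
replace (v - z - (v - z) * 1) with (RtoC 0) by ring.
rewrite Cmod_0. generalize (Cmod_ge_0 (v - z)). nra.
Qed.

Lemma cderiv_shift (a z : C) : cderiv (fun w => w - a) z (RtoC 1).
Proof. apply cderiv_eps. intros eps He. exists 1%R. split; [lra|]. intros v _.
replace (v - a - (z - a) - (v - z) * 1) with (RtoC 0) by ring.
rewrite Cmod_0. generalize (Cmod_ge_0 (v - z)). nra.
Qed.

(** The product and chain rules hold for C as a normed module over itself, with the
    uniform structure of its norm; C_NormedModule carries the product one. *)
Lemma cderiv_C_AbsRing f z l : cderiv f z l <-> @is_derive C_AbsRing (AbsRing_NormedModule C_AbsRing) f z l.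
Proof.
split; intros [H1 H2]; split; try exact H2.
- apply (is_linear_scal_l (K:=C_AbsRing) (V:=AbsRing_NormedModule C_AbsRing)).
- apply (is_linear_scal_l (K:=C_AbsRing) (V:=C_NormedModule)).
Qed.

Lemma cderiv_mult (f g : C -> C) z l m : cderiv f z l -> cderiv g z m ->
  cderiv (fun w => f w * g w) z (l * g z + f z * m).
Proof.
rewrite !cderiv_C_AbsRing. intros Hf Hg. apply (is_derive_mult (K:=C_AbsRing));
  auto. apply Cmult_comm.
Qed.

Lemma cderiv_comp (f g : C -> C) z l m : cderiv f (g z) l -> cderiv g z m ->
  cderiv (fun w => f (g w)) z (m * l).
Proof.
rewrite (cderiv_C_AbsRing g). intros Hf Hg.
  apply (is_derive_comp (K:=C_AbsRing) (V:=C_NormedModule) f g); auto.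
Qed.

Lemma Cmod_minus_rev a b : (Cmod a - Cmod b <= Cmod (a - b))%R.
Proof. generalize (Cmod_triangle (a - b) b). replace (a - b + b) with a by ring. lra. Qed.

Lemma cderiv_inv (z : C) : z <> 0 -> cderiv Cinv z (- / (z * z)).
Proof.
intros Hz. apply cderiv_eps. intros eps He.
assert (P : (0 < Cmod z)%R) by (apply Cmod_gt_0; auto).
set (M := (eps * (Cmod z * Cmod z * (Cmod z / 2)))%R).
assert (HM : (0 < M)%R) by (unfold M; repeat apply Rmult_lt_0_compat; lra).
exists (Rmin (Cmod z / 2) M). split. apply Rmin_case; lra.
intros w Hw.
assert (H1 : (Cmod (w - z) < Cmod z / 2)%R) by (eapply Rlt_le_trans; [apply Hw|]; apply Rmin_l).
assert (H2 : (Cmod (w - z) < M)%R) by (eapply Rlt_le_trans; [apply Hw|]; apply Rmin_r).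
assert (H3 : (Cmod z / 2 < Cmod w)%R).
{ generalize (Cmod_minus_rev z w). replace (z - w) with (- (w - z)) by ring. rewrite Cmod_opp.
  lra. }
assert (Hw0 : w <> 0) by (apply Cmod_gt_0; lra).
replace (/ w - / z - (w - z) * (- / (z * z))) with
  ((w - z) * (w - z) / (z * z * w)) by (field; auto).
rewrite Cmod_div by (repeat apply Cmult_neq_0; auto). rewrite !Cmod_mult.
apply Rmult_le_reg_r with (Cmod z * Cmod z * Cmod w)%R. { repeat apply Rmult_lt_0_compat; lra. }
unfold Rdiv. rewrite Rmult_assoc, Rinv_l, Rmult_1_r.
2:{ apply Rgt_not_eq. repeat apply Rmult_lt_0_compat; lra. }
replace (eps * Cmod (w - z) * (Cmod z * Cmod z * Cmod w))%R with
  (Cmod (w - z) * (eps * (Cmod z * Cmod z * Cmod w)))%R by ring.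
apply Rmult_le_compat_l. apply Cmod_ge_0.
apply Rle_trans with M. lra. unfold M. apply Rmult_le_compat_l;
  [lra|]. apply Rmult_le_compat_l; [nra|lra].
Qed.

(** * Cauchy's formula *)

(** The period is normalised to 1, so that circles are parametrised by [0,1] and
    means over circles carry no factor 1 / (2 pi). *)
Definition cis (y : R) : C := (cos (2 * PI * y), sin (2 * PI * y)).

Lemma Cmod_cis y : Cmod (cis y) = 1%R.
Proof.
unfold Cmod, cis; cbn [fst snd]. rewrite <- sqrt_1. f_equal.
  generalize (sin2_cos2 (2 * PI * y)). unfold Rsqr. simpl; lra.
Qed.

Lemma cis_0_1 : cis 0 = cis 1.
Proof. unfold cis. rewrite Rmult_0_r, Rmult_1_r, cos_0, sin_0, cos_2PI, sin_2PI. reflexivity.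
  Qed.

Lemma rderiv_cis y : rderiv cis y (2 * PI * Ci * cis y).
Proof.
replace (2 * PI * Ci * cis y) with ((- (2 * PI * sin (2 * PI * y)))%R,
  (2 * PI * cos (2 * PI * y))%R).
- apply rderiv_pair; auto_derive; auto; ring.
- apply injective_projections; simpl; ring.
Qed.

Lemma rderiv_affine (A B : C) t : rderiv (fun x : R => A + x * B) t B.
Proof.
apply rderiv_eps. intros eps He. exists 1%R. split; [lra|]. intros s _.
rewrite RtoC_minus.
replace (A + s * B - (A + t * B) - (s - t) * B) with (RtoC 0) by ring.
rewrite Cmod_0. generalize (Rabs_pos (s - t)). nra.
Qed.

Lemma rderiv_affine_comp (A B : C) c t l : rderiv c t l ->
  rderiv (fun x : R => A + B * c x) t (B * l).
Proof.
intros H. replace (B * l) with (l * B) by ring.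
apply (rderiv_comp (fun w => A + B * w) c); auto.
apply (is_derive_ext (K:=C_AbsRing) (V:=C_NormedModule) (fun w => A + B * (w - 0))).
- intros w. apply (f_equal (fun v => A + B * v)). ring.
- apply cderiv_affine.
Qed.

Lemma ccont_const (a : C) t : ccont (fun _ => a) t.
Proof. apply (continuous_const (U := R_UniformSpace) (V := C_R_NormedModule)). Qed.

Lemma ccont_cis t : ccont cis t.
Proof. eapply rderiv_ccont, rderiv_cis. Qed.

Lemma ccont_affine_comp (A B : C) c t : ccont c t -> ccont (fun x : R => A + B * c x) t.
Proof.
intros H. apply (continuous_plus (V := C_R_NormedModule)). apply ccont_const.
apply ccont_mult; auto. apply ccont_const.
Qed.

Lemma Cplus_cancel_sides (a b c : C) : a + b - a - c = 0 -> b = c.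
Proof. intros H. replace b with (a + b - a - c + c) by ring. rewrite H. ring. Qed.

Lemma Cmult_cancel_l (a b c : C) : a <> 0 -> a * b = a * c -> b = c.
Proof. intros Ha H. replace b with (a * b / a) by (field; auto). rewrite H. field; auto. Qed.

Lemma circle_off_disk z (rho : R) y : (Cmod z < rho)%R ->
  (rho - Cmod z <= Cmod (rho * cis y - z))%R.
Proof.
intros H. eapply Rle_trans; [|apply Cmod_minus_rev].
rewrite Cmod_mult, Cmod_cis, Cmod_R, Rabs_pos_eq; [lra|]. generalize (Cmod_ge_0 z); lra.
Qed.

Lemma circle_neq z (rho : R) y : (Cmod z < rho)%R -> rho * cis y - z <> 0.
Proof. intros H. apply Cmod_gt_0. generalize (circle_off_disk z rho y H). lra. Qed.

Lemma inv_kernel_continuous z (rho : R) y : (Cmod z < rho)%R ->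
  ccont (fun y => / (rho * cis y - z)) y.
Proof.
intros H. apply (ccont_cderiv_comp (fun w => / (w - z))
  (fun y => rho * cis y) y (1 * - / ((rho * cis y - z) * (rho * cis y - z)))).
- apply (cderiv_comp Cinv (fun w => w - z)). apply cderiv_inv, circle_neq, H.
  apply cderiv_shift.
- apply ccont_mult. apply ccont_const. apply ccont_cis.
Qed.

Lemma boundary_continuous (f : C -> C) (rho : R) y : (exists l, cderiv f (rho * cis y) l) ->
  ccont (fun y => f (rho * cis y) * (rho * cis y)) y.
Proof.
intros [l Hl]. assert (ccont (fun y => rho * cis y) y) by (apply ccont_mult;
  [apply ccont_const|apply ccont_cis]).
apply ccont_mult; auto. apply (ccont_cderiv_comp f (fun y => rho * cis y) y l); auto.
Qed.

Lemma cauchy_kernel_continuous (f : C -> C) z (rho : R) y : (Cmod z < rho)%R ->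
  (exists l, cderiv f (rho * cis y) l) ->
  ccont (fun y => f (rho * cis y) * (rho * cis y) * / (rho * cis y - z)) y.
Proof.
intros H Hf. apply ccont_mult. apply boundary_continuous, Hf. apply inv_kernel_continuous, H.
Qed.

Lemma is_CInt_const_unit (a : C) : is_CInt (fun _ => a) 0 1 a.
Proof.
assert (E : @scal R_AbsRing C_R_NormedModule (1 - 0)%R a = a).
{ rewrite Rminus_0_r. apply (scal_one (K:=R_AbsRing) (V:=C_R_NormedModule)). }
assert (H := is_RInt_const (V := C_R_NormedModule) 0 1 a).
change (is_CInt (fun _ => a) 0 1 (@scal R_AbsRing C_R_NormedModule (1 - 0)%R a)) in H.
  rewrite E in H. exact H.
Qed.

Lemma Cminus_eq_0_eq (a b : C) : a - b = 0 -> a = b.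
Proof. intros H. replace a with (a - b + b) by ring. rewrite H. ring. Qed.

Section Homotopy.
Variables (f : C -> C) (z : C) (r rho : R).
Hypothesis Hr : (0 < r)%R.
Hypothesis HR : (Cmod z + r <= rho)%R.
Hypothesis Hf : forall w, (Cmod w <= rho)%R -> exists l, cderiv f w l.

Let Phi (x y : R) := (z + r * cis y) + x * (- z + (rho - r) * cis y).

Lemma Phi_alt x y : Phi x y = (1 - x)%R * z + ((1 - x) * r + x * rho)%R * cis y.
Proof. unfold Phi. rewrite !RtoC_plus, !RtoC_mult, !RtoC_minus. ring. Qed.

(** Goursat's theorem for w |-> f w / (w - z) on the family of circles that
    interpolates affinely between the circle of radius r at z and the one of
    radius rho at 0.  None of them meets z.  The edges y = 0 and y = 1 have the
    same image and cancel; on the small circle the denominator cancels against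
    the derivative of the parametrisation. *)
Lemma cauchy_circle_homotopy :
  CInt (fun y => f (rho * cis y) * (rho * cis y) * / (rho * cis y - z)) 0 1
  = CInt (fun y => f (z + r * cis y)) 0 1.
Proof.
generalize (Cmod_ge_0 z); intros Hz0.
set (g := fun w => f w * / (w - z)).
assert (B0 : forall x, (0 <= x <= 1)%R -> (0 < (1 - x) * r + x * rho)%R).
{ intros x Hx. destruct (Req_dec x 0) as [->|N]. lra. assert (0 < x * rho)%R by nra. nra. }
assert (Hin : forall x y, (0 <= x <= 1)%R -> (Cmod (Phi x y) <= rho)%R).
{ intros x y Hx. rewrite Phi_alt. eapply Rle_trans. apply Cmod_triangle.
  rewrite !Cmod_mult, Cmod_cis, !Cmod_R. rewrite !Rabs_pos_eq; try lra. 2: apply Rlt_le, B0;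
    auto. nra. }
assert (Hne : forall x y, (0 <= x <= 1)%R -> Phi x y - z <> 0).
{ intros x y Hx E. assert (E' : RtoC ((1 - x) * r + x * rho) * cis y = x * z).
  { rewrite Phi_alt, RtoC_minus in E.
    replace (RtoC ((1 - x) * r + x * rho) * cis y) with
      ((1 - x) * z + ((1 - x) * r + x * rho)%R * cis y - z + x * z) by ring.
    rewrite E. ring. }
  apply (f_equal Cmod) in E'. rewrite !Cmod_mult, Cmod_cis, !Cmod_R, !Rabs_pos_eq in E';
    try lra. 2: apply Rlt_le, B0; auto.
  nra. }
assert (G := goursat_square g Phi (fun x y => - z + (rho - r) * cis y)
  (fun x y => ((1 - x) * r + x * rho)%R * (2 * PI * Ci * cis y))
   (Rmax (rho + rho) (rho * (2 * PI)))).
cbv zeta in G.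
assert (Cpi : forall y, Cmod (2 * PI * Ci * cis y) = (2 * PI)%R).
{ intros y. rewrite !Cmod_mult, Cmod_cis, Cmod_Ci, !Cmod_R. generalize PI_RGT_0. intros.
  rewrite !Rabs_pos_eq; lra. }
assert (Gx : forall x y, (0 <= x <= 1)%R -> (0 <= y <= 1)%R ->
  rderiv (fun x => Phi x y) x (- z + (rho - r) * cis y)).
{ intros. apply rderiv_affine. }
lapply G; clear G; [intros G|exact Gx].
lapply G; clear G; [intros G|].
2:{ intros x y Hx Hy. eapply (is_derive_ext (V := C_R_NormedModule)). intros t. symmetry.
  apply Phi_alt.
    apply rderiv_affine_comp. apply rderiv_cis. }
lapply G; clear G; [intros G|].
2:{ intros x y Hx Hy. apply ccont_const. }
lapply G; clear G; [intros G|].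
2:{ intros x y Hx Hy. apply ccont_mult. apply ccont_const. apply ccont_mult.
  apply ccont_const. apply ccont_cis. }
lapply G; clear G; [intros G|].
2:{ intros x y Hx Hy. eapply Rle_trans; [|apply Rmax_l]. eapply Rle_trans;
  [apply Cmod_triangle|].
    rewrite Cmod_opp, Cmod_mult, Cmod_cis, <- RtoC_minus, Cmod_R, Rabs_pos_eq; lra. }
lapply G; clear G; [intros G|].
2:{ intros x y Hx Hy. eapply Rle_trans;
  [|apply Rmax_r]. rewrite Cmod_mult, Cpi, Cmod_R, Rabs_pos_eq by (apply Rlt_le, B0; auto).
    apply Rmult_le_compat_r. generalize PI_RGT_0; lra. nra. }
assert (Hg : forall x y, (0 <= x <= 1)%R -> exists l, cderiv g (Phi x y) l).
{ intros x y Hx. destruct (Hf (Phi x y)) as [l Hl]; auto. eexists. apply cderiv_mult. exact Hl.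
  apply (cderiv_comp Cinv (fun w => w - z)). apply cderiv_inv. apply Hne; auto.
  apply cderiv_shift. }
lapply G; clear G; [intros G|]. 2: intros; apply Hg; auto.
rewrite (RInt_ext (V := C_R_CompleteNormedModule)
  (fun x => g (Phi x 1) * (- z + (rho - r) * cis 1))
  (fun x => g (Phi x 0) * (- z + (rho - r) * cis 0))) in G.
2:{ intros x _. unfold Phi. rewrite cis_0_1. reflexivity. }
set (I1 := CInt (fun y => g (Phi 1 y) * (((1 - 1) * r + 1 * rho)%R * (2 * PI * Ci * cis y))) 0 1) in *.
set (I0 := CInt (fun y => g (Phi 0 y) * (((1 - 0) * r + 0 * rho)%R * (2 * PI * Ci * cis y))) 0 1) in *.
assert (E : I1 = I0).
{ apply (Cplus_cancel_sides _ _ _ G). }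
assert (K : 2 * PI * Ci <> 0).
{ intros K. specialize (Cpi 0%R). rewrite K, Cmult_0_l, Cmod_0 in Cpi. generalize PI_RGT_0;
  lra. }
assert (C1 : forall y, ccont
  (fun y => f (rho * cis y) * (rho * cis y) * / (rho * cis y - z)) y).
{ intros y. apply cauchy_kernel_continuous;
  [lra|]. apply Hf. rewrite Cmod_mult, Cmod_cis, Cmod_R, Rabs_pos_eq; lra. }
assert (C0 : forall y, ccont (fun y => f (z + r * cis y)) y).
{ intros y.
  destruct (Hf (z + r * cis y)) as [l Hl].
  { eapply Rle_trans. apply Cmod_triangle. rewrite Cmod_mult, Cmod_cis, Cmod_R, Rabs_pos_eq;
    lra. }
  apply (ccont_cderiv_comp f (fun y => z + r * cis y) y l);
    auto. apply ccont_affine_comp, ccont_cis. }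
assert (E1 : I1 = (2 * PI * Ci) * CInt
  (fun y => f (rho * cis y) * (rho * cis y) * / (rho * cis y - z)) 0 1).
{ apply CInt_unique.
  eapply (is_RInt_ext (V:=C_R_NormedModule)). 2: apply is_CInt_mult_l, CInt_correct;
    [lra|intros; apply C1].
  intros y _. unfold g. replace (Phi 1 y) with (rho * cis y) by (unfold Phi; ring).
  replace ((1 - 1) * r + 1 * rho)%R with rho by ring. unfold Cdiv.
    change (2 * PI * Ci * (f (rho * cis y) * (rho * cis y) * / (rho * cis y - z)) =
    f (rho * cis y) * / (rho * cis y - z) * (rho * (2 * PI * Ci * cis y))). ring. }
assert (E0 : I0 = (2 * PI * Ci) * CInt (fun y => f (z + r * cis y)) 0 1).
{ apply CInt_unique.
  eapply (is_RInt_ext (V:=C_R_NormedModule)). 2: apply is_CInt_mult_l, CInt_correct;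
    [lra|intros; apply C0].
  intros y _. unfold g. replace (Phi 0 y) with (z + r * cis y) by (unfold Phi; ring).
  replace ((1 - 0) * r + 0 * rho)%R with r by ring.
  assert (N : cis y <> 0) by (apply Cmod_gt_0; rewrite Cmod_cis; lra).
  assert (N' : RtoC r <> 0) by (apply Cmod_gt_0; rewrite Cmod_R, Rabs_pos_eq; lra).
  change (2 * PI * Ci * f (z + r * cis y)
    = f (z + r * cis y) * / (z + r * cis y - z) * (r * (2 * PI * Ci * cis y))).
  replace (z + r * cis y - z) with (r * cis y) by ring. field. auto. }
rewrite E1, E0 in E.
apply (Cmult_cancel_l _ _ _ K E).
Qed.

End Homotopy.

(** The mean of f over small circles around z tends to f z by continuity, while
    by the homotopy it does not depend on the radius. *)
Lemma cauchy_formula (f : C -> C) (z : C) (rho : R) :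
  (Cmod z < rho)%R -> (forall w, (Cmod w <= rho)%R -> exists l, cderiv f w l) ->
  is_CInt (fun y => f (rho * cis y) * (rho * cis y) * / (rho * cis y - z)) 0 1 (f z).
Proof.
intros Hz Hf.
assert (Cb : forall y, (Cmod (rho * cis y) <= rho)%R).
{ intros y. rewrite Cmod_mult, Cmod_cis, Cmod_R, Rabs_pos_eq;
  [lra|]. generalize (Cmod_ge_0 z); lra. }
set (F := fun y => f (rho * cis y) * (rho * cis y) * / (rho * cis y - z)).
assert (HF : is_CInt F 0 1 (CInt F 0 1)).
{ apply CInt_correct; [lra|]. intros; apply cauchy_kernel_continuous; auto. }
replace (f z) with (CInt F 0 1); auto.
apply Cminus_eq_0_eq. apply Cmod_eq_0. apply Rle_antisym; [|apply Cmod_ge_0].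
apply Rle_plus_epsilon. intros eps He. rewrite Rplus_0_l.
destruct (Hf z) as [l Hl]; [lra|].
destruct (cderiv_lip _ _ _ Hl) as [d [Hd0 Hd]].
assert (P : (0 < Cmod l + 1)%R) by (generalize (Cmod_ge_0 l); lra).
set (e := (eps / (Cmod l + 1))%R).
assert (He' : (0 < e)%R) by (apply Rdiv_lt_0_compat; auto).
set (r := Rmin (Rmin (d / 2) (rho - Cmod z)) e).
assert (r0 : (0 < r)%R) by (repeat apply Rmin_case; lra).
assert (r1 : (r <= d / 2)%R) by (eapply Rle_trans; [apply Rmin_l|apply Rmin_l]).
assert (r2 : (r <= rho - Cmod z)%R) by (eapply Rle_trans; [apply Rmin_l|apply Rmin_r]).
assert (r3 : (r <= e)%R) by apply Rmin_r.
unfold F. rewrite (cauchy_circle_homotopy f z r rho); auto; [|lra].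
assert (Hr : forall y, Cmod (z + r * cis y - z) = r).
{ intros y. replace (z + r * cis y - z) with (r * cis y) by ring.
  rewrite Cmod_mult, Cmod_cis, Cmod_R, Rabs_pos_eq; lra. }
replace eps with ((1 - 0) * eps)%R by ring.
apply (is_CInt_norm_le (fun y => f (z + r * cis y) - f z)).
- lra.
- intros y _. eapply Rle_trans. apply Hd. rewrite Hr. lra. rewrite Hr.
  apply Rle_trans with ((Cmod l + 1) * e)%R. apply Rmult_le_compat_l; lra. right; unfold e;
    field; lra.
- apply is_CInt_minus.
  + apply CInt_correct; [lra|]. intros t _. destruct (Hf (z + r * cis t)) as [m Hm].
    { eapply Rle_trans. apply Cmod_triangle. rewrite Cmod_mult, Cmod_cis, Cmod_R, Rabs_pos_eq;
      lra. }
    apply (ccont_cderiv_comp f (fun y => z + r * cis y) t m);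
      auto. apply ccont_affine_comp, ccont_cis.
  + apply is_CInt_const_unit.
Qed.

(** * Derivatives of holomorphic functions are holomorphic *)

(** A second-order remainder, uniform in the parameter, survives integration. *)
Lemma cderiv_under_integral (K : C -> R -> C) (dK : R -> C) (F : C -> C) (z l : C) (M d : R) :
  (0 < d)%R -> (0 <= M)%R ->
  (forall w y, (Cmod (w - z) < d)%R -> (0 <= y <= 1)%R ->
     (Cmod (K w y - K z y - (w - z) * dK y) <= M * (Cmod (w - z) * Cmod (w - z)))%R) ->
  (forall w, (Cmod (w - z) < d)%R -> is_CInt (K w) 0 1 (F w)) ->
  is_CInt dK 0 1 l -> cderiv F z l.
Proof.
intros Hd HM HK HF Hl. apply cderiv_eps. intros eps He.
exists (Rmin d (eps / (M + 1))). split. apply Rmin_case; auto. apply Rdiv_lt_0_compat; lra.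
intros w Hw.
assert (H1 : (Cmod (w - z) < d)%R) by (eapply Rlt_le_trans; [apply Hw|]; apply Rmin_l).
assert (H2 : (Cmod (w - z) < eps / (M + 1))%R) by (eapply Rlt_le_trans; [apply Hw|];
  apply Rmin_r).
generalize (Cmod_ge_0 (w - z)); intros H0.
apply Rle_trans with ((1 - 0) * (M * (Cmod (w - z) * Cmod (w - z))))%R.
- apply (is_CInt_norm_le (fun y => K w y - K z y - (w - z) * dK y)); [lra|intros; apply HK;
  auto|].
  apply is_CInt_minus. apply is_CInt_minus; apply HF; auto.
  replace (z - z) with (RtoC 0) by ring. rewrite Cmod_0. auto. apply is_CInt_mult_l, Hl.
- replace ((1 - 0) * (M * (Cmod (w - z) * Cmod (w - z))))%R with
  (M * Cmod (w - z) * Cmod (w - z))%R by ring.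
  apply Rmult_le_compat_r; auto.
  apply Rle_trans with ((M + 1) * (eps / (M + 1)))%R; [|right; field; lra].
  apply Rmult_le_compat; lra.
Qed.

Lemma Cmod_maximum (phi : R -> C) : (forall y, (0 <= y <= 1)%R -> ccont phi y) ->
  exists m, (0 <= m <= 1)%R /\ forall y, (0 <= y <= 1)%R -> (Cmod (phi y) <= Cmod (phi m))%R.
Proof.
intros H.
destruct (continuity_ab_maj (fun y => Cmod (phi y)) 0 1) as [m [Hm Hm1]].
- lra.
- intros c Hc. apply continuity_pt_filterlim.
  apply (continuous_ext (T:=R_UniformSpace) (U:=R_UniformSpace)
    (fun y => @norm R_AbsRing C_R_NormedModule (phi y))).
  intros; apply norm_C_R. apply (continuous_comp phi). apply H, Hc.
    apply (filterlim_norm (V:=C_R_NormedModule)).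
- exists m. split; [exact Hm1|exact Hm].
Qed.

Section Cauchy_transform.
Variables (phi : R -> C) (rho : R).
Hypothesis Hphi : forall y, (0 <= y <= 1)%R -> ccont phi y.

Definition cauchy_transform phi (rho : R) (n : nat) (z : C) : C := CInt
  (fun y => phi y * (/ (rho * cis y - z)) ^ n) 0 1.

Lemma inv_kernel_pow_continuous n z y : (Cmod z < rho)%R ->
  ccont (fun y => (/ (rho * cis y - z)) ^ n) y.
Proof.
intros Hz. induction n; simpl. apply ccont_const. apply ccont_mult;
  auto. apply inv_kernel_continuous, Hz.
Qed.

Lemma cauchy_transform_correct n z : (Cmod z < rho)%R ->
  is_CInt (fun y => phi y * (/ (rho * cis y - z)) ^ n) 0 1 (cauchy_transform phi rho n z).
Proof.
intros Hz. apply CInt_correct; [lra|]. intros y Hy. apply ccont_mult;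
  auto. apply inv_kernel_pow_continuous, Hz.
Qed.

Lemma inv_circle_bound z y d : (0 < d)%R -> (Cmod z + d <= rho)%R ->
  (Cmod (/ (rho * cis y - z)) <= / d)%R.
Proof.
intros Hd Hz. rewrite Cmod_inv by (apply circle_neq; lra). apply Rinv_le_contravar; auto.
generalize (circle_off_disk z rho y). lra.
Qed.

(** For a = 1/(zeta - z), b = 1/(zeta - w) and h = w - z one has b - a = h a b,
    so this bounds the second-order remainder of z |-> 1/(zeta - z)^n. *)
Lemma pow_remainder_bound (n : nat) : exists C0, (0 <= C0)%R /\
  forall (a b h : C) (B : R), b - a = h * (a * b) -> (Cmod a <= B)%R -> (Cmod b <= B)%R ->
    (Cmod (b ^ n - a ^ n - h * (INR n * a ^ S n)) <= C0 * B ^ (n + 2) * (Cmod h * Cmod h))%R.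
Proof.
induction n as [|n [C0 [HC IH]]].
- exists 0%R. split; [lra|]. intros a b h B _ _ _. simpl.
  replace (1 - 1 - h * (0 * (a * 1))) with (RtoC 0) by ring. rewrite Cmod_0. lra.
- exists (C0 + INR (S n))%R. assert (Hn := pos_INR (S n)). split;
  [lra|]. intros a b h B E Ha Hb.
  replace (b ^ S n - a ^ S n - h * (INR (S n) * a ^ S (S n))) with
    (b * (b ^ n - a ^ n - h * (INR n * a ^ S n)) + INR (S n) * (a ^ S (S n) * b) * (h * h)).
  2:{ assert (D : b - a - h * (a * b) = 0) by (rewrite E; ring).
      rewrite S_INR, RtoC_plus. simpl Cpow.
      set (p := a ^ n). set (q := b ^ n). set (m := RtoC (INR n)).
      transitivity (b * (q - p - h * (m * (a * p))) + (m + 1) * (a * (a * p) * b) * (h * h) + ((m + 1) * h * a * p + p) * (b - a - h * (a * b)));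
      [rewrite D|]; ring. }
  replace ((C0 + INR (S n)) * B ^ (S n + 2) * (Cmod h * Cmod h))%R with
    (B * (C0 * B ^ (n + 2) * (Cmod h * Cmod h)) + INR (S n) * (B ^ S (S n) * B) * (Cmod h * Cmod h))%R.
  2:{ replace (n + 2)%nat with (S (S n)) by (rewrite Nat.add_comm; reflexivity).
      replace (S n + 2)%nat with (S (S (S n))) by (rewrite Nat.add_comm; reflexivity). simpl;
        ring. }
  generalize (Cmod_ge_0 a) (Cmod_ge_0 b) (Cmod_ge_0 h); intros.
  eapply Rle_trans; [apply Cmod_triangle|]. apply Rplus_le_compat.
  + rewrite Cmod_mult. apply Rmult_le_compat; auto using Cmod_ge_0.
  + rewrite !Cmod_mult, Cmod_R, Rabs_pos_eq by auto. apply Rmult_le_compat_r; [nra|].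
    apply Rmult_le_compat_l; auto. apply Rmult_le_compat; auto using Cmod_ge_0.
    rewrite Cmod_pow. apply pow_incr. auto.
Qed.

Lemma cderiv_cauchy_transform n z :
  (Cmod z < rho)%R -> cderiv (cauchy_transform phi rho n) z (INR n * cauchy_transform phi rho (S n) z).
Proof.
intros Hz. destruct (pow_remainder_bound n) as [C0 [HC Hrem]].
set (d := ((rho - Cmod z) / 2)%R).
assert (Hd : (0 < d)%R) by (unfold d; lra).
destruct (Cmod_maximum phi Hphi) as [m [_ HA']].
set (A := Cmod (phi m)) in *. assert (HA : (0 <= A)%R) by apply Cmod_ge_0.
assert (Hid : (0 < / d)%R) by (apply Rinv_0_lt_compat; auto).
assert (Hin : forall w, (Cmod (w - z) < d)%R -> (Cmod w + d <= rho)%R).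
{ intros w Hw. generalize (Cmod_minus_rev w z). unfold d in *. lra. }
apply cderiv_under_integral with (K := fun w y => phi y * (/ (rho * cis y - w)) ^ n)
  (dK := fun y => INR n * (phi y * (/
    (rho * cis y - z)) ^ S n)) (M := (A * (C0 * (/ d) ^ (n + 2)))%R) (d := d); auto.
- apply Rmult_le_pos; auto. apply Rmult_le_pos; auto. apply pow_le; lra.
- intros w y Hw Hy. specialize (Hin w Hw).
  set (a := / (rho * cis y - z)). set (b := / (rho * cis y - w)).
  replace (phi y * b ^ n - phi y * a ^ n - (w - z) * (INR n * (phi y * a ^ S n))) with
   (phi y * (b ^ n - a ^ n - (w - z) * (INR n * a ^ S n))) by ring.
  rewrite Cmod_mult, Rmult_assoc. apply Rmult_le_compat; try apply Cmod_ge_0; auto.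
  assert (Nz : rho * cis y - z <> 0) by (apply circle_neq; lra).
  assert (Nw : rho * cis y - w <> 0) by (apply circle_neq; lra).
  apply Hrem.
  + unfold a, b. field. auto.
  + apply inv_circle_bound; auto. unfold d; lra.
  + apply inv_circle_bound; auto.
- intros w Hw. specialize (Hin w Hw). apply cauchy_transform_correct; lra.
- apply is_CInt_mult_l. apply cauchy_transform_correct; auto.
Qed.

End Cauchy_transform.

Lemma cderiv_ext_disk (f g : C -> C) (z l : C) (rho : R) : (Cmod z < rho)%R ->
  (forall w, (Cmod w < rho)%R -> f w = g w) -> cderiv f z l -> cderiv g z l.
Proof.
intros Hz He Hf. apply cderiv_eps. intros eps H.
destruct (proj1 (cderiv_eps f z l) Hf eps H) as [d [Hd Hd']].
exists (Rmin d (rho - Cmod z)). split. apply Rmin_case; lra.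
intros w Hw.
assert (H1 : (Cmod (w - z) < d)%R) by (eapply Rlt_le_trans; [apply Hw|]; apply Rmin_l).
assert (H2 : (Cmod (w - z) < rho - Cmod z)%R) by (eapply Rlt_le_trans; [apply Hw|];
  apply Rmin_r).
rewrite <- !He; auto. generalize (Cmod_minus_rev w z). lra.
Qed.

(** On a smaller disk f is a Cauchy transform of order 1, hence f' is one of
    order 2, which is again differentiable. *)
Lemma analytic_C_derive f : analytic_on_disk f -> analytic_on_disk (C_derive f).
Proof.
intros Hf z Hz. unfold unit_disk in Hz.
set (rho := ((Cmod z + 1) / 2)%R).
assert (H1 : (Cmod z < rho)%R) by (unfold rho; lra).
assert (Hrho : (rho < 1)%R) by (unfold rho; lra).
assert (Hd : forall w, (Cmod w <= rho)%R -> exists l, cderiv f w l).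
{ intros w Hw. apply Hf. unfold unit_disk. lra. }
set (phi := fun y => f (rho * cis y) * (rho * cis y)).
assert (Hphi : forall y, (0 <= y <= 1)%R -> ccont phi y).
{ intros y _. apply boundary_continuous. apply Hd.
  rewrite Cmod_mult, Cmod_cis, Cmod_R, Rabs_pos_eq; [lra|].
  generalize (Cmod_ge_0 z); lra. }
assert (E1 : forall w, (Cmod w < rho)%R -> cauchy_transform phi rho 1 w = f w).
{ intros w Hw. apply CInt_unique. eapply (is_RInt_ext (V:=C_R_NormedModule)).
  2: apply cauchy_formula; eauto.
  intros y _. unfold phi. simpl. rewrite Cmult_1_r. reflexivity. }
assert (E2 : forall w, (Cmod w < rho)%R -> cauchy_transform phi rho 2 w = C_derive f w).
{ intros w Hw. symmetry. apply is_C_derive_unique.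
  apply cderiv_ext_disk with (cauchy_transform phi rho 1) rho; auto.
  replace (cauchy_transform phi rho 2 w) with
    (INR 1 * cauchy_transform phi rho 2 w) by (simpl; ring).
  apply cderiv_cauchy_transform; auto. }
eexists. apply cderiv_ext_disk with (cauchy_transform phi rho 2) rho; auto.
apply cderiv_cauchy_transform; auto.
Qed.

(** * A second-order Euler equation on [0,1] *)

Lemma rderiv_Re (f : R -> C) t (l : C) : rderiv f t l -> is_derive (fun s => Re (f s)) t (Re l).
Proof.
intros H. unfold is_derive.
apply (filterdiff_ext_lin _ (fun y : R => Re (@scal R_AbsRing C_R_NormedModule y l))).
- apply (filterdiff_comp' (U:=R_NormedModule) (V:=C_R_NormedModule) (W:=R_NormedModule) f Re t _ Re H).
  apply filterdiff_linear. apply (is_linear_fst (U:=R_NormedModule) (V:=R_NormedModule)).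
- intros y. reflexivity.
Qed.

Section Real_part.
Open Scope R_scope.

Lemma derivative_nonneg_at_left_max (D : R -> R) m l :
  0 < m -> is_derive D m l -> (forall s, 0 <= s <= m -> D s <= D m) -> 0 <= l.
Proof.
intros Hm Hd Hmax. apply Rnot_lt_le. intros Hl.
apply is_derive_Reals in Hd. destruct (Hd (- l)%R ltac:(lra)) as [d Hdd].
assert (Hd0 := cond_pos d).
set (h := Rmin (d / 2) m).
assert (h0 : 0 < h) by (apply Rmin_case; lra).
assert (h1 : h <= d / 2) by apply Rmin_l. assert (h2 : h <= m) by apply Rmin_r.
specialize (Hdd (- h) ltac:(lra)). rewrite Rabs_Ropp, Rabs_pos_eq in Hdd by lra.
specialize (Hdd ltac:(lra)). apply Rabs_def2 in Hdd.
specialize (Hmax (m + - h) ltac:(lra)).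
assert (0 <= (D (m + - h) - D m) / - h).
{ replace ((D (m + - h) - D m) / - h) with ((D m - D (m + - h)) / h) by (field; lra).
  apply Rdiv_le_0_compat; lra. }
lra.
Qed.

(** At a point m where y s - N s / c has a positive maximum, the hypothesis
    would force y1 m < 0, although the derivative there cannot be below N / c >= 0. *)
Lemma euler_first_order_bound (y y1 : R -> R) (g c N : R) :
  0 < g -> 0 < c -> 0 <= N -> y 0 = 0 ->
  (forall s, 0 <= s <= 1 -> is_derive y s (y1 s)) ->
  (forall s, 0 <= s <= 1 -> g * s * y1 s + c * y s <= N * s) ->
  forall s, 0 <= s <= 1 -> y s <= N / c * s.
Proof.
intros Hg Hc HN Hy0 Hy H s0 Hs0. apply Rnot_lt_le. intros Hbad.
set (D := fun s => y s - N / c * s).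
assert (HD : forall s, 0 <= s <= 1 -> is_derive D s (y1 s - N / c)).
{ intros s Hs. apply (is_derive_minus (K:=R_AbsRing) (V:=R_NormedModule)). apply Hy, Hs.
  auto_derive; auto; ring. }
destruct (continuity_ab_maj D 0 s0) as [m [Hm Hm1]].
- lra.
- intros t Ht. apply continuity_pt_filterlim. apply (ex_derive_continuous (V:=R_NormedModule)).
  eexists. apply HD. lra.
- assert (Dm : D s0 <= D m) by (apply Hm; lra).
  assert (Dpos : 0 < D s0) by (unfold D; lra).
  assert (Nc : 0 <= N / c) by (apply Rdiv_le_0_compat; lra).
  assert (m0 : 0 < m).
  { destruct (proj1 Hm1) as [L|E];
    auto. exfalso. rewrite <- E in Dm. unfold D in Dm at 2. rewrite Hy0 in Dm. lra. }
  assert (K : 0 <= y1 m - N / c).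
  { apply (derivative_nonneg_at_left_max D m); auto. apply HD; lra. intros; apply Hm; lra. }
  specialize (H m ltac:(lra)).
  assert (E : c * y m = N * m + c * D m) by (unfold D; field; lra).
  assert (0 <= g * m * y1 m) by (apply Rmult_le_pos; [nra|lra]).
  assert (0 < c * D m) by (apply Rmult_lt_0_compat; lra). lra.
Qed.

End Real_part.

(** The modulus is the supremum of the real parts of the rotated vector. *)
Lemma Cmod_le_Re (v : C) K : (0 <= K)%R -> (forall lam, Cmod lam = 1%R ->
  (Re (lam * v) <= K)%R) -> (Cmod v <= K)%R.
Proof.
intros HK H. destruct (Req_dec (Cmod v) 0) as [E|N]. lra.
assert (P : (0 < Cmod v)%R) by (generalize (Cmod_ge_0 v); lra).
assert (N' : RtoC (Cmod v) <> 0) by (apply Cmod_gt_0; rewrite Cmod_R, Rabs_pos_eq; lra).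
assert (E : Cconj v / Cmod v * v = Cmod v).
{ transitivity (v * Cconj v / Cmod v). field; auto. rewrite <- Cmod2_conj, RtoC_pow. field;
  auto. }
specialize (H (Cconj v / Cmod v)). rewrite E in H. apply H.
rewrite Cmod_div by auto. rewrite Cmod_conj, Cmod_R, Rabs_pos_eq by lra. field. lra.
Qed.

Lemma ccont_bound_at_0 (f : R -> C) K : ccont f 0%R -> (forall s, (0 < s <= 1)%R ->
  (Cmod (f s) <= K)%R) -> (Cmod (f 0%R) <= K)%R.
Proof.
intros Hf H. apply Rle_plus_epsilon. intros eps He.
destruct (proj1 (ccont_eps f 0) Hf eps He) as [d [Hd Hd']].
set (s := Rmin (d / 2) 1).
assert (s0 : (0 < s)%R) by (apply Rmin_case; lra).
assert (s1 : (s <= d / 2)%R) by apply Rmin_l. assert (s2 : (s <= 1)%R) by apply Rmin_r.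
specialize (Hd' s). rewrite Rminus_0_r, Rabs_pos_eq in Hd' by lra. specialize (Hd' ltac:(lra)).
specialize (H s ltac:(lra)).
replace (f 0%R) with (f s + - (f s - f 0%R)) by ring.
eapply Rle_trans. apply Cmod_triangle. rewrite Cmod_opp. lra.
Qed.

(** Let M be the maximum of |u1|.  Treating u as part of the right-hand side,
    which is then at most (B + M) s, the first-order bound gives
    |s u1| <= (B + M) s / c, hence M <= (B + M) / c. *)
Lemma euler_second_order_bound (u u1 v1 : R -> C) (g c B : R) :
  (0 < g)%R -> (1 < c)%R -> (0 <= B)%R -> u 0%R = 0 ->
  (forall s, (0 <= s <= 1)%R -> rderiv u s (u1 s)) ->
  (forall s, (0 <= s <= 1)%R -> ccont u1 s) ->
  (forall s, (0 <= s <= 1)%R -> rderiv (fun s => s * u1 s) s (v1 s)) ->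
  (forall s, (0 <= s <= 1)%R -> (Cmod (g * s * v1 s + c * (s * u1 s) + u s) <= B * s)%R) ->
  (Cmod (u 1%R) <= B / (c - 1))%R.
Proof.
intros Hg Hc HB Hu0 Hu Cu1 Hv H.
destruct (Cmod_maximum u1 Cu1) as [m [Hm HM]].
set (M := Cmod (u1 m)) in *.
assert (M0 : (0 <= M)%R) by apply Cmod_ge_0.
assert (Bu : forall s, (0 <= s <= 1)%R -> (Cmod (u s) <= M * s)%R).
{ intros s Hs. replace (u s) with (u s - u 0%R) by (rewrite Hu0; ring).
  replace (M * s)%R with ((s - 0) * M)%R by ring.
  apply rderiv_increment_le with u1; [lra|..]; intros t Ht; [apply Hu|apply Cu1|apply HM];
    lra. }
assert (Bv : forall s, (0 <= s <= 1)%R -> (Cmod (s * u1 s) <= (B + M) / c * s)%R).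
{ intros s Hs. apply Cmod_le_Re.
  { apply Rmult_le_pos; [apply Rdiv_le_0_compat|]; lra. }
  intros lam Hlam.
  apply (euler_first_order_bound (fun s => Re (lam * (s * u1 s)))
    (fun s => Re (lam * v1 s)) g c (B + M)); auto; try lra.
  - rewrite Cmult_0_l, Cmult_0_r. reflexivity.
  - intros t Ht. apply rderiv_Re.
    apply (is_derive_ext (V := C_R_NormedModule) (fun s => 0 + lam * (s * u1 s))).
    intros; apply Cplus_0_l. apply (rderiv_affine_comp 0 lam (fun s => s * u1 s)). auto.
  - intros t Ht.
    replace (g * t * Re (lam * v1 t) + c * Re (lam * (t * u1 t)))%R
      with (Re (lam * (g * t * v1 t + c * (t * u1 t) + u t) + - (lam * u t))).
    2:{ unfold Re; simpl. ring. }
    eapply Rle_trans; [apply Rle_abs|]. eapply Rle_trans; [apply re_le_Cmod|].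
    eapply Rle_trans; [apply Cmod_triangle|].
    rewrite Cmod_opp, !Cmod_mult, Hlam. specialize (H t Ht). specialize (Bu t Ht). lra. }
assert (Bu1 : forall s, (0 < s <= 1)%R -> (Cmod (u1 s) <= (B + M) / c)%R).
{ intros s Hs. specialize (Bv s ltac:(lra)).
  rewrite Cmod_mult, Cmod_R, Rabs_pos_eq in Bv by lra.
  apply Rmult_le_reg_r with s; lra. }
assert (BM : (M <= (B + M) / c)%R).
{ destruct (Req_dec m 0) as [E|N].
  - unfold M. rewrite E at 1. apply ccont_bound_at_0; auto. apply Cu1; lra.
  - apply Bu1. lra. }
eapply Rle_trans. apply Bu; lra. rewrite Rmult_1_r.
apply Rmult_le_reg_r with (c - 1)%R. lra. replace (B / (c - 1) * (c - 1))%R with B by (field;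
  lra).
apply Rmult_le_compat_r with (r := c) in BM; [|lra].
replace ((B + M) / c * c)%R with (B + M)%R in BM by (field; lra). lra.
Qed.

(** * The exponential and the sine *)

Lemma exp_le x y : (x <= y)%R -> (exp x <= exp y)%R.
Proof. intros [H| ->]; [apply Rlt_le, exp_increasing, H|apply Rle_refl]. Qed.

Lemma Cexp_plus (a b : C) : Cexp (a + b) = Cexp a * Cexp b.
Proof.
unfold Cexp, Re, Im. simpl. rewrite exp_plus, cos_plus, sin_plus.
apply injective_projections; simpl; ring.
Qed.

Lemma Cexp_0 : Cexp 0 = 1.
Proof. unfold Cexp. simpl. rewrite exp_0, cos_0, sin_0. apply injective_projections; simpl;
  ring. Qed.

Lemma Cmod_Cexp z : Cmod (Cexp z) = exp (Re z).
Proof.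
unfold Cmod, Cexp. cbn [fst snd]. transitivity (sqrt (exp (Re z) ^ 2));
  [|apply sqrt_pow2, Rlt_le, exp_pos].
f_equal. generalize (sin2_cos2 (Im z)). unfold Rsqr. intros E.
transitivity (exp (Re z) ^ 2 * (sin (Im z) * sin (Im z) + cos (Im z) * cos (Im z)))%R;
  [ring|rewrite E; ring].
Qed.

Lemma rderiv_Cexp_ray (m : C) t : rderiv (fun s : R => Cexp (s * m)) t (m * Cexp (t * m)).
Proof.
destruct m as [a b].
apply (is_derive_ext (V := C_R_NormedModule) (fun s : R => (exp (s * a) * cos (s * b),
  exp (s * a) * sin (s * b))%R)).
- intros s. unfold Cexp; simpl. rewrite !Rmult_0_l, Rminus_0_r, Rplus_0_r. reflexivity.
- replace ((a, b) * Cexp (t * (a, b))) with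
   ((a * exp (t * a) * cos (t * b) - exp (t * a) * (b * sin (t * b)))%R,
     (a * exp (t * a) * sin (t * b) + exp (t * a) * (b * cos (t * b)))%R).
  + apply rderiv_pair; auto_derive; auto; ring.
  + unfold Cexp; simpl. rewrite !Rmult_0_l, Rminus_0_r, Rplus_0_r.
    apply injective_projections; simpl; ring.
Qed.

Lemma Cmod_Cexp_le z : (Cmod (Cexp z) <= exp (Cmod z))%R.
Proof.
rewrite Cmod_Cexp. apply exp_le. eapply Rle_trans. apply Rle_abs. apply re_le_Cmod.
Qed.

Lemma Cexp_minus_1_bound (m : C) : (Cmod (Cexp m - 1) <= Cmod m * exp (Cmod m))%R.
Proof.
replace (Cexp m - 1) with (Cexp (1%R * m) - Cexp (0%R * m)) by (rewrite Cmult_0_l, Cmult_1_l,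
  Cexp_0; ring).
replace (Cmod m * exp (Cmod m))%R with ((1 - 0) * (Cmod m * exp (Cmod m)))%R by ring.
apply (rderiv_increment_le (fun t : R => Cexp (t * m)) (fun t : R => m * Cexp (t * m)));
  [lra|..]; intros t Ht.
- apply rderiv_Cexp_ray.
- apply ccont_mult. apply ccont_const. eapply rderiv_ccont, rderiv_Cexp_ray.
- rewrite Cmod_mult. apply Rmult_le_compat_l. apply Cmod_ge_0.
  eapply Rle_trans. apply Cmod_Cexp_le. apply exp_le.
    rewrite Cmod_mult, Cmod_R, Rabs_pos_eq by lra.
  generalize (Cmod_ge_0 m). nra.
Qed.

Lemma Cexp_remainder_bound (m : C) : (Cmod (Cexp m - 1 - m)
  <= Cmod m * Cmod m * exp (Cmod m))%R.
Proof.
replace (Cexp m - 1 - m) with ((Cexp (1%R * m) + 1%R * (- m)) - (Cexp (0%R * m) + 0%R * (- m)))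
  by (rewrite Cmult_0_l, Cmult_1_l, Cexp_0; ring).
replace (Cmod m * Cmod m * exp (Cmod m))%R with
  ((1 - 0) * (Cmod m * (Cmod m * exp (Cmod m))))%R by ring.
apply (rderiv_increment_le (fun t : R => Cexp (t * m) + t * - m)
  (fun t : R => m * Cexp (t * m) + - m)); [lra|..]; intros t Ht.
- apply (is_derive_plus (V := C_R_NormedModule)). apply rderiv_Cexp_ray.
  apply (is_derive_ext (V := C_R_NormedModule) (fun t : R => 0 + t * - m)). intros;
    apply Cplus_0_l.
  apply rderiv_affine.
- apply (continuous_plus (V := C_R_NormedModule)). apply ccont_mult. apply ccont_const.
  eapply rderiv_ccont, rderiv_Cexp_ray.
  apply ccont_const.
- replace (m * Cexp (t * m) + - m) with (m * (Cexp (t * m) - 1)) by ring.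
  rewrite Cmod_mult. apply Rmult_le_compat_l. apply Cmod_ge_0.
  eapply Rle_trans. apply Cexp_minus_1_bound.
  assert (L : (Cmod (t * m) <= Cmod m)%R).
  { rewrite Cmod_mult, Cmod_R, Rabs_pos_eq by lra. generalize (Cmod_ge_0 m). nra. }
  apply Rmult_le_compat; auto. apply Cmod_ge_0. apply Rlt_le, exp_pos. apply exp_le, L.
Qed.

Lemma cderiv_Cexp (z : C) : cderiv Cexp z (Cexp z).
Proof.
apply cderiv_eps. intros eps He.
set (K := (exp (Re z) * exp 1)%R).
assert (HK : (0 < K)%R) by (apply Rmult_lt_0_compat; apply exp_pos).
exists (Rmin 1 (eps / K)). split. apply Rmin_case; [lra|]. apply Rdiv_lt_0_compat; auto.
intros w Hw.
assert (H1 : (Cmod (w - z) < 1)%R) by (eapply Rlt_le_trans; [apply Hw|]; apply Rmin_l).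
assert (H2 : (Cmod (w - z) < eps / K)%R) by (eapply Rlt_le_trans; [apply Hw|]; apply Rmin_r).
replace (Cexp w) with (Cexp z * Cexp (w - z)).
2:{ rewrite <- Cexp_plus. f_equal. ring. }
replace (Cexp z * Cexp (w - z) - Cexp z - (w - z) * Cexp z) with
  (Cexp z * (Cexp (w - z) - 1 - (w - z))) by ring.
rewrite Cmod_mult, Cmod_Cexp.
set (m := w - z) in *. generalize (Cmod_ge_0 m); intros H0.
apply Rle_trans with (exp (Re z) * (Cmod m * Cmod m * exp 1))%R.
- apply Rmult_le_compat_l. apply Rlt_le, exp_pos. eapply Rle_trans. apply Cexp_remainder_bound.
  apply Rmult_le_compat_l. nra. apply exp_le; lra.
- replace (exp (Re z) * (Cmod m * Cmod m * exp 1))%R with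
  (K * Cmod m * Cmod m)%R by (unfold K; ring).
  apply Rmult_le_compat_r; auto. apply Rle_trans with (K * (eps / K))%R.
  apply Rmult_le_compat_l; lra. right; field; lra.
Qed.

(** Integrate the derivative of t |-> exp(itw) - exp(-itw) over [0,1]; for real x
    in [-1,1] one of exp x, exp (-x) is at most 1 and the other at most e <= 3. *)
Lemma Csin_bound (w : C) : (Cmod w <= 1)%R -> (Cmod (Csin w) <= 2 * Cmod w)%R.
Proof.
intros Hw. set (m := Ci * w).
assert (Em : Cmod m = Cmod w) by (unfold m; rewrite Cmod_mult, Cmod_Ci; ring).
assert (K : (Cmod (Cexp m - Cexp (- m)) <= 4 * Cmod w)%R).
{ replace (Cexp m - Cexp (- m)) with
  ((Cexp (1%R * m) - Cexp (1%R * - m)) - (Cexp (0%R * m) - Cexp (0%R * - m)))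
    by (rewrite !Cmult_0_l, !Cmult_1_l; ring).
  replace (4 * Cmod w)%R with ((1 - 0) * (4 * Cmod w))%R by ring.
  apply (rderiv_increment_le (fun t : R => Cexp (t * m) - Cexp (t * - m))
    (fun t : R => m * Cexp (t * m) - - m * Cexp (t * - m))); [lra|..]; intros t Ht.
  - apply (is_derive_minus (V := C_R_NormedModule)); apply rderiv_Cexp_ray.
  - apply (continuous_minus (V := C_R_NormedModule)); (apply ccont_mult;
    [apply ccont_const|eapply rderiv_ccont, rderiv_Cexp_ray]).
  - replace (m * Cexp (t * m) - - m * Cexp (t * - m)) with
    (m * (Cexp (t * m) + Cexp (t * - m))) by ring.
    rewrite Cmod_mult, Em, Rmult_comm. apply Rmult_le_compat_r. apply Cmod_ge_0.
    eapply Rle_trans. apply Cmod_triangle. rewrite !Cmod_Cexp.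
    replace (t * - m) with (- (t * m)) by ring.
    set (x := Re (t * m)). replace (Re (- (t * m))) with (- x)%R by reflexivity.
    assert (X : (Rabs x <= 1)%R).
    { eapply Rle_trans. apply re_le_Cmod. rewrite Cmod_mult, Cmod_R, Rabs_pos_eq, Em by lra.
      generalize (Cmod_ge_0 w). nra. }
    apply Rabs_le_between in X. generalize exp_le_3; intros E3.
    destruct (Rle_dec 0 x).
    + assert (exp x <= exp 1)%R by (apply exp_le;
      lra). assert (exp (- x) <= exp 0)%R by (apply exp_le; lra). rewrite exp_0 in *. lra.
    + assert (exp (- x) <= exp 1)%R by (apply exp_le;
      lra). assert (exp x <= exp 0)%R by (apply exp_le; lra). rewrite exp_0 in *. lra. }
unfold Csin. fold m.
assert (T : Cmod (2 * Ci) = 2%R) by (rewrite Cmod_mult, Cmod_Ci, Cmod_R, Rabs_pos_eq; lra).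
rewrite Cmod_div by (apply Cmod_gt_0; lra). rewrite T. lra.
Qed.

(** * The principal logarithm *)

(** The chain rule read backwards: to first order w - z equals l (g w - g z), which
    first bounds the increment of g by a multiple of |w - z| and then gives its
    derivative. *)
Lemma cderiv_local_inverse (f g : C -> C) (z l : C) (r : R) : (0 < r)%R ->
  (forall w, (Cmod (w - z) < r)%R -> f (g w) = w) ->
  (forall eps, (0 < eps)%R -> exists d, (0 < d)%R /\ forall w, (Cmod (w - z) < d)%R ->
    (Cmod (g w - g z) < eps)%R) ->
  cderiv f (g z) l -> l <> 0 -> cderiv g z (/ l).
Proof.
intros Hr Hfg Hc Hf Hl. apply cderiv_eps. intros eps He.
assert (P : (0 < Cmod l)%R) by (apply Cmod_gt_0; auto).
set (e := Rmin (Cmod l / 2) (eps * (Cmod l * Cmod l) / 2)).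
assert (He0 : (0 < e)%R). { apply Rmin_case. lra. apply Rdiv_lt_0_compat;
  [|lra]. repeat apply Rmult_lt_0_compat; lra. }
assert (e1 : (e <= Cmod l / 2)%R) by apply Rmin_l.
  assert (e2 : (e <= eps * (Cmod l * Cmod l) / 2)%R) by apply Rmin_r.
destruct (proj1 (cderiv_eps _ _ _) Hf e He0) as [d1 [Hd1 D1]].
destruct (Hc d1 Hd1) as [d2 [Hd2 D2]].
exists (Rmin r d2). split. apply Rmin_case; auto. intros w Hw.
assert (H1 : (Cmod (w - z) < r)%R) by (eapply Rlt_le_trans; [apply Hw|]; apply Rmin_l).
assert (H2 : (Cmod (w - z) < d2)%R) by (eapply Rlt_le_trans; [apply Hw|]; apply Rmin_r).
specialize (D1 _ (D2 w H2)). rewrite !Hfg in D1; auto.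
2:{ replace (z - z) with (RtoC 0) by ring. rewrite Cmod_0. auto. }
set (k := g w - g z) in *.
assert (A : (Cmod k * Cmod l <= Cmod (w - z) + e * Cmod k)%R).
{ rewrite <- Cmod_mult. replace (k * l) with ((w - z) + - (w - z - k * l)) by ring.
  eapply Rle_trans. apply Cmod_triangle. rewrite Cmod_opp. lra. }
generalize (Cmod_ge_0 k) (Cmod_ge_0 (w - z)); intros Hk Hwz.
assert (A2 : (Cmod k * Cmod l <= 2 * Cmod (w - z))%R) by nra.
replace (k - (w - z) * / l) with (- (w - z - k * l) / l) by (field; auto).
rewrite Cmod_div, Cmod_opp by auto.
apply Rmult_le_reg_r with (Cmod l);
  auto. unfold Rdiv. rewrite Rmult_assoc, Rinv_l, Rmult_1_r by lra.
eapply Rle_trans. apply D1.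
apply Rle_trans with (eps * (Cmod l * Cmod l) / 2 * Cmod k)%R. apply Rmult_le_compat_r; auto.
replace (eps * (Cmod l * Cmod l) / 2 * Cmod k)%R with
  (eps * Cmod l / 2 * (Cmod k * Cmod l))%R by field.
replace (eps * Cmod (w - z) * Cmod l)%R with (eps * Cmod l / 2 * (2 * Cmod (w - z)))%R by field.
apply Rmult_le_compat_l; auto. apply Rlt_le, Rdiv_lt_0_compat;
  [|lra]. apply Rmult_lt_0_compat; lra.
Qed.

Lemma Cmod_le_Rabs_Re_Im (z : C) : (Cmod z <= Rabs (Re z) + Rabs (Im z))%R.
Proof.
replace z with (RtoC (Re z) + Ci * RtoC (Im z)) at 1.
- eapply Rle_trans. apply Cmod_triangle. rewrite Cmod_mult, Cmod_Ci, !Cmod_R. lra.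
- destruct z as [x y]. apply injective_projections; simpl; ring.
Qed.

(** On the right half-plane this is the principal branch. *)
Definition Clog (z : C) : C := (ln (Cmod z), atan (Im z / Re z)).

Lemma Cexp_Clog z : (0 < Re z)%R -> Cexp (Clog z) = z.
Proof.
destruct z as [x y]. unfold Cexp, Clog, Re, Im; cbn [fst snd]. intros Hx.
assert (Q : (0 < 1 + (y / x)²)%R) by (generalize (Rle_0_sqr (y / x)); lra).
assert (S0 : (0 < sqrt (1 + (y / x)²))%R) by (apply sqrt_lt_R0; auto).
assert (M : Cmod (x, y) = (x * sqrt (1 + (y / x)²))%R).
{ unfold Cmod; cbn [fst snd].
  replace (x ^ 2 + y ^ 2)%R with (x ^ 2 * (1 + (y / x)²))%R by (unfold Rsqr; field; lra).
  rewrite sqrt_mult by (auto using pow2_ge_0 with real). rewrite sqrt_pow2 by lra.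
    reflexivity. }
rewrite exp_ln by (rewrite M; apply Rmult_lt_0_compat; auto).
rewrite cos_atan, sin_atan, M. f_equal; field; lra.
Qed.

Lemma Clog_1 : Clog 1 = 0.
Proof.
unfold Clog. rewrite Cmod_1, ln_1. unfold Re, Im;
  simpl. unfold Rdiv. rewrite Rmult_0_l, atan_0. reflexivity.
Qed.

Lemma locally_C_eps (z : C) (P : C -> Prop) : @locally C_UniformSpace z P ->
  exists d, (0 < d)%R /\ forall w, (Cmod (w - z) < d)%R -> P w.
Proof.
intros [d Hd]. exists d. split. apply cond_pos. intros w Hw. apply Hd.
exact (C_NormedModule_mixin_compat1 z w d Hw).
Qed.

Lemma Clog_continuous z : (0 < Re z)%R -> forall eps, (0 < eps)%R -> exists d, (0 < d)%R /\
  forall w, (Cmod (w - z) < d)%R -> (Cmod (Clog w - Clog z) < eps)%R.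
Proof.
intros Hz eps He.
assert (Pz : (0 < Cmod z)%R) by (eapply Rlt_le_trans; [apply Hz|]; eapply Rle_trans;
  [apply Rle_abs|apply re_le_Cmod]).
assert (He2 : (0 < eps / 2)%R) by lra.
assert (C1 : @continuous C_UniformSpace R_UniformSpace (fun w => ln (Cmod w)) z).
{ apply (continuous_comp (U:=C_UniformSpace) (fun w : C => Cmod w) ln); [|apply continuous_ln;
  auto].
  apply (continuous_ext (T:=C_UniformSpace) (U:=R_UniformSpace)
    (fun y => @norm R_AbsRing C_R_NormedModule y)).
  intros; apply norm_C_R. apply (filterlim_norm (V:=C_R_NormedModule)). }
assert (C2 : @continuous C_UniformSpace R_UniformSpace (fun w => atan (Im w / Re w)) z).
{ apply (continuous_comp (U:=C_UniformSpace) (fun w : C => (Im w / Re w)%R) atan);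
  [|apply continuous_atan].
  apply (continuous_mult (U:=C_UniformSpace) (K:=R_AbsRing)).
    apply (continuous_snd (U:=R_UniformSpace) (V:=R_UniformSpace)).
  apply (continuous_comp (U:=C_UniformSpace) (fun w : C => Re w) Rinv).
    apply (continuous_fst (U:=R_UniformSpace) (V:=R_UniformSpace)).
  apply continuous_Rinv. lra. }
destruct (locally_C_eps _ _ (C1 _ (locally_ball _ (mkposreal _ He2)))) as [d1 [Hd1 D1]].
destruct (locally_C_eps _ _ (C2 _ (locally_ball _ (mkposreal _ He2)))) as [d2 [Hd2 D2]].
exists (Rmin d1 d2). split. apply Rmin_case; auto. intros w Hw.
assert (H1 := D1 w (Rlt_le_trans _ _ _ Hw (Rmin_l _ _))).
assert (H2 := D2 w (Rlt_le_trans _ _ _ Hw (Rmin_r _ _))).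
eapply Rle_lt_trans. apply Cmod_le_Rabs_Re_Im.
change (Rabs (ln (Cmod w) - ln (Cmod z)) < eps / 2)%R in H1.
change (Rabs (atan (Im w / Re w) - atan (Im z / Re z)) < eps / 2)%R in H2.
change (Rabs (ln (Cmod w) - ln (Cmod z)) + Rabs (atan (Im w / Re w) - atan (Im z / Re z)) < eps)%R. lra.
Qed.

Lemma cderiv_Clog z : (0 < Re z)%R -> cderiv Clog z (/ z).
Proof.
intros Hz.
apply (cderiv_local_inverse Cexp Clog z z (Re z)); auto.
- intros w Hw. apply Cexp_Clog. generalize (re_le_Cmod (w - z)). intros H.
  assert (K : (Rabs (Re w - Re z) < Re z)%R) by (eapply Rle_lt_trans; [apply H|apply Hw]).
  apply Rabs_def2 in K. lra.
- apply Clog_continuous; auto.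
- rewrite <- (Cexp_Clog z) at 2 by auto. apply cderiv_Cexp.
- intros E. rewrite E in Hz. simpl in Hz. lra.
Qed.

Lemma Rabs_atan_le t : (Rabs (atan t) <= Rabs t)%R.
Proof.
destruct (MVT_gen atan 0 t (fun x => / (1 + x²))%R) as [c [_ Hc]].
- intros x _. apply is_derive_atan.
- intros x _. apply continuity_pt_filterlim. apply continuous_atan.
- rewrite atan_0, !Rminus_0_r in Hc. rewrite Hc, Rabs_mult.
  generalize (Rle_0_sqr c); intros.
  rewrite Rabs_pos_eq by (apply Rlt_le, Rinv_0_lt_compat; lra).
  rewrite <- (Rmult_1_l (Rabs t)) at 2. apply Rmult_le_compat_r. apply Rabs_pos.
  rewrite <- Rinv_1. apply Rinv_le_contravar; lra.
Qed.

Lemma Rabs_ln_le x r : (0 <= r < 1)%R -> (1 - r <= x <= 1 + r)%R ->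
  (Rabs (ln x) <= r / (1 - r))%R.
Proof.
intros Hr Hx.
assert (L : forall y, (0 < y)%R -> (ln y <= y - 1)%R).
{ intros y Hy. generalize (exp_ineq1_le (ln y)). rewrite exp_ln by auto. lra. }
assert (A := L x ltac:(lra)). assert (B := L (/ x)%R ltac:(apply Rinv_0_lt_compat; lra)).
rewrite ln_Rinv in B by lra.
assert (I : (/ x <= / (1 - r))%R) by (apply Rinv_le_contravar; lra).
replace (r / (1 - r))%R with (/ (1 - r) - 1)%R by (field; lra).
assert (1 + r <= / (1 - r))%R.
{ apply Rmult_le_reg_r with (1 - r)%R; [lra|]. rewrite Rinv_l by lra. nra. }
apply Rabs_le. lra.
Qed.

Lemma Clog_bound u : (Cmod u <= 1 / 3)%R -> (Cmod (Clog (1 + u)) <= 3 * Cmod u)%R.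
Proof.
intros Hu. set (r := Cmod u) in *. assert (r0 : (0 <= r)%R) by apply Cmod_ge_0.
assert (X : (r / (1 - r) <= 3 / 2 * r)%R).
{ apply Rmult_le_reg_r with (1 - r)%R;
  [lra|]. unfold Rdiv. rewrite Rmult_assoc, Rinv_l by lra. nra. }
eapply Rle_trans. apply Cmod_le_Rabs_Re_Im.
replace (3 * r)%R with (3 / 2 * r + 3 / 2 * r)%R by field.
apply Rplus_le_compat; eapply Rle_trans; try apply X; unfold Clog; cbn [Re Im fst snd].
- apply Rabs_ln_le. lra.
  generalize (Cmod_triangle 1 u) (Cmod_minus_rev 1 (- u)).
    replace (1 - - u) with (1 + u) by ring.
  rewrite Cmod_opp, Cmod_1. fold r. lra.
- eapply Rle_trans. apply Rabs_atan_le.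
  change (Rabs ((0 + Im u) / (1 + Re u)) <= r / (1 - r))%R.
  assert (A := re_le_Cmod u). assert (B := Rle_trans _ _ _ (Rmax_r _ _) (Rmax_Cmod u)).
  fold r in A, B. change (Rabs (Im u) <= r)%R in B. apply Rabs_le_between in A.
  rewrite Rplus_0_l. unfold Rdiv. rewrite Rabs_mult.
  rewrite (Rabs_pos_eq (/ _)) by (apply Rlt_le, Rinv_0_lt_compat; lra).
  apply Rmult_le_compat; auto. apply Rabs_pos. apply Rlt_le, Rinv_0_lt_compat; lra.
  apply Rinv_le_contravar; lra.
Qed.

(** * The subordination *)

(** Already e >= 2 and sinh 1 >= 1/2 give e (e + 1) + e sinh 1 >= 7. *)
Lemma gamma_gap (gamma1 gamma2 : R) : (0 < gamma1)%R -> (0 < gamma2)%R ->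
  ((gamma1 - gamma2 - exp 1 * (exp 1 + 1) >= exp 1 * sinh 1)%R \/
    (1 - exp 1 * (1 + gamma1 + gamma2) >= sinh 1)%R) ->
  (7 <= gamma1 - gamma2)%R.
Proof.
intros H1 H2 H.
assert (E : (2 <= exp 1)%R) by (generalize (exp_ineq1_le 1); lra).
assert (S : (1 / 2 <= sinh 1)%R).
{ unfold sinh. assert (exp (- (1)) <= exp 0)%R by (apply exp_le;
  lra). rewrite exp_0 in H0. lra. }
destruct H as [H|H]; nra.
Qed.

(** Along the ray through z, in terms of u = p(sz) - 1 and v = s u', the
    differential operator of the hypothesis is u + (gamma1 - gamma2) v +
    gamma2 s v' because s v' = s u' + s^2 u''. *)
Lemma subordination_distance (gamma1 gamma2 : R) (p : C -> C) :
  (0 < gamma2)%R -> (7 <= gamma1 - gamma2)%R -> analytic_on_disk p -> p 0 = 1 ->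
  subordinate
    (fun z => p z + gamma1 * z * C_derive p z + gamma2 * z ^ 2 * C_derive (C_derive p) z)
    (fun z => 1 + Csin z) ->
  forall z, unit_disk z -> (Cmod (p z - 1) <= Cmod z / 3)%R.
Proof.
intros Hg Hc Hp Hp0 [w [_ [_ [_ [Hw Heq]]]]] z Hz.
assert (Hin : forall s, (0 <= s <= 1)%R -> unit_disk (s * z)).
{ intros s Hs. unfold unit_disk in *. rewrite Cmod_mult, Cmod_R, Rabs_pos_eq by lra.
  generalize (Cmod_ge_0 z). nra. }
assert (Hray : forall s, rderiv (fun s : R => s * z) s z).
{ intros s. apply (is_derive_ext (V := C_R_NormedModule) (fun s : R => 0 + s * z)). intros;
  apply Cplus_0_l. apply rderiv_affine. }
assert (D1 : forall v, unit_disk v -> cderiv p v (C_derive p v)).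
{ intros v Hv. apply C_derive_correct. exact v. apply Hp, Hv. }
assert (D2 : forall v, unit_disk v -> cderiv (C_derive p) v (C_derive (C_derive p) v)).
{ intros v Hv. apply C_derive_correct. exact v. apply analytic_C_derive; auto. }
assert (Hz0 := Cmod_ge_0 z).
assert (K : (Cmod (p (1%R * z)%C - 1) <= 2 * Cmod z / (gamma1 - gamma2 - 1))%R).
{ apply (euler_second_order_bound (fun s : R => p (s * z) - 1)
  (fun s : R => z * C_derive p (s * z))
   (fun s : R => z * (1 * C_derive p (s * z) + s * z * C_derive (C_derive p) (s * z))) gamma2); auto; try lra.
  - rewrite Cmult_0_l, Hp0. ring.
  - intros s Hs. apply (rderiv_comp (fun v => p v - 1) (fun s : R => s * z)); auto.
    replace (C_derive p (s * z)) with (C_derive p (s * z) * 1) by ring.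
    apply (cderiv_comp (fun v => v - 1) p). apply cderiv_shift. auto.
  - intros s Hs. apply ccont_mult. apply ccont_const. eapply ccont_cderiv_comp. apply D2;
    auto. eapply rderiv_ccont, Hray.
  - intros s Hs.
    apply (is_derive_ext (V := C_R_NormedModule) (fun s : R =>
      (fun v => v * C_derive p v) (s * z))).
    { intros t. exact (eq_sym (Cmult_assoc _ _ _)). }
    apply (rderiv_comp (fun v => v * C_derive p v) (fun s : R => s * z)); [|apply Hray].
    apply (cderiv_mult (fun v => v)); [apply cderiv_id|]. apply D2; auto.
  - intros s Hs. specialize (Heq _ (Hin s Hs)). cbv beta in Heq.
    replace (gamma2 * s * (z * (1 * C_derive p (s * z) + s * z * C_derive (C_derive p) (s * z))) +
       (gamma1 - gamma2)%R * (s * (z * C_derive p (s * z))) + (p (s * z) - 1)) with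
         (Csin (w (s * z))).
    + eapply Rle_trans. apply Csin_bound.
      { generalize (Hw _ (Hin s Hs)) (Hin s Hs). unfold unit_disk. lra. }
      specialize (Hw _ (Hin s Hs)). rewrite (Cmod_mult s z), Cmod_R, Rabs_pos_eq in Hw by lra.
        lra.
    + replace (Csin (w (s * z))) with (1 + Csin (w (s * z)) - 1) by ring. rewrite <- Heq.
      rewrite RtoC_minus. ring. }
rewrite Cmult_1_l in K. eapply Rle_trans. apply K.
apply Rmult_le_reg_r with (gamma1 - gamma2 - 1)%R. lra.
unfold Rdiv. rewrite Rmult_assoc, Rinv_l by lra. nra.
Qed.

Theorem theorem3p1 (gamma1 gamma2 : R)
  (Hgamma1 : (0 < gamma1)%R) (Hgamma2 : (0 < gamma2)%R)
  (Hgamma :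
    (gamma1 - gamma2 - exp 1 * (exp 1 + 1) >= exp 1 * sinh 1)%R \/
    (1 - exp 1 * (1 + gamma1 + gamma2) >= sinh 1)%R)
  (p : C -> C) (Hp : analytic_on_disk p) (Hp0 : p 0 = 1)
  (Hsub : subordinate
    (fun z => p z + gamma1 * z * C_derive p z
              + gamma2 * z ^ 2 * C_derive (C_derive p) z)
    (fun z => 1 + Csin z)) :
  subordinate p Cexp.
Proof.
assert (Hdist := subordination_distance gamma1 gamma2 p Hgamma2 (gamma_gap _ _ Hgamma1 Hgamma2 Hgamma) Hp Hp0 Hsub).
assert (Hre : forall z, unit_disk z -> (0 < Re (p z))%R).
{ intros z Hz. assert (A := re_le_Cmod (p z - 1)). specialize (Hdist z Hz).
  unfold unit_disk in Hz.
  change (Rabs (Re (p z) - 1) <= Cmod (p z - 1))%R in A. apply Rabs_le_between in A. lra. }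
assert (Hle : forall z, unit_disk z -> (Cmod (Clog (p z)) <= Cmod z)%R).
{ intros z Hz. specialize (Hdist z Hz). unfold unit_disk in Hz.
  replace (p z) with (1 + (p z - 1)) by ring. eapply Rle_trans. apply Clog_bound; lra. lra. }
exists (fun z => Clog (p z)). repeat split.
- intros z Hz. destruct (Hp z Hz) as [l Hl]. exists (l * / p z).
  apply (cderiv_comp Clog p); auto. apply cderiv_Clog; auto.
- intros z Hz. generalize (Hle z Hz). unfold unit_disk in *. lra.
- rewrite Hp0. apply Clog_1.
- exact Hle.
- intros z Hz. symmetry. apply Cexp_Clog; auto.
Qed.
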